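(* Let $M$ be a persistence module with a resolution $0 \to M \to E^\bullet$ (an exact sequence $0\to M\to E^0\to E^1\to\cdots$ of persistence modules). This is the minimal injective resolution of $M$ if and only if $(E^\bullet)^\vee \to M^\vee \to 0$ is the minimal flat resolution of $M^\vee$. Further, let $F_\bullet \to M \to 0$ be a resolution (an exact sequence $\cdots\to F_1\to F_0\to M\to 0$ of persistence modules), where each $F_i$ is pointwise finite-dimensional. Then $F_\bullet \to M \to 0$ is the minimal flat resolution of $M$ if and only if $0 \to M^\vee \to F_\bullet^\vee$ is the minimal injective resolution of $M^\vee$.
   Context: Fix $n \in \mathbb{N}$, a field $\mathbf{k}$, and the polynomial ring $R = \mathbf{k}[x_1,\dots,x_n]$, $\mathbb{Z}^n$-graded by $\deg x_i = \mathbf{e}_i$ (standard basis vector). A persistence module is a $\mathbb{Z}^n$-graded $R$-module $M=\bigoplus_{\mathbf a\in\mathbb Z^n} M_{\mathbf a}$; a morphism is a degree-preserving $R$-linear map, and $\operatorname{Nat}(M,N)$ is the set of morphisms. The shift is $M(\mathbf{a})_{\mathbf{d}} = M_{\mathbf{a}+\mathbf{d}}$. The graded Hom is $\underline{\operatorname{Hom}}(M,N) = \bigoplus_{\mathbf{a}\in\mathbb{Z}^n} \operatorname{Nat}(M,N(\mathbf{a}))$. $M$ is pointwise finite-dimensional if $\dim_{\mathbf{k}} M_{\mathbf{a}}<\infty$ for all $\mathbf{a}$. A persistence module $F$ is flat if $F\otimes_R -$ is exact on persistence modules, and $E$ is injective if $\underline{\operatorname{Hom}}(-,E)$ is exact on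 persistence modules (i.e. injective in the graded category). A monomorphism $M\to E$ is an injective hull if $E$ is injective and every nonzero (graded) submodule of $E$ meets the image of $M$ nontrivially; $E(M)$ denotes the injective hull of $M$. A morphism $f\colon F\to M$ with $F$ flat is a flat precover if every morphism $F'\to M$ with $F'$ flat factors through $f$; it is a flat cover if moreover every morphism $h\colon F\to F$ with $fh=f$ is an isomorphism. A resolution $0\to M\xrightarrow{d^{-1}}E^0\xrightarrow{d^0}E^1\to\cdots$ is the minimal injective resolution if $\operatorname{im} d^{i-1}\subseteq E^i$ is the injective hull for every $i\in\mathbb{N}$ (starting from $i=0$). A resolution $\cdots\xrightarrow{d_2}F_1\xrightarrow{d_1}F_0\xrightarrow{d_0}M\to0$ is the minimal flat resolution if $F_i\to\operatorname{im} d_i$ is a flat cover for every $i\in\mathbb{N}$ (starting from $i=0$). The Matlis dual is the contravariant exact functor $M^\vee = \underline{\operatorname{Hom}}(M,E(\mathbf{k}))$, where $\mathbf{k}=R/\langle x_1,\dots,x_n\rangle$; it is isomorphic to $M\mapsto\bigoplus_{\mathbf{a}\in\mathbb{Z}^n} \operatorname{Hom}_{\mathbf{k}}(M_{-\mathbf{a}},\mathbf{k})$. *)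

(* Defs.v *)
From HB Require Import structures.
From mathcomp Require Import all_boot all_order all_algebra.
From mathcomp Require Import boolp.
From mathcomp.multinomials Require Import mpoly.

Set Implicit Arguments.
Unset Strict Implicit.
Unset Printing Implicit Defensive.

Import Order.TTheory GRing.Theory Num.Theory.
Local Open Scope ring_scope.
Local Open Scope quotient_scope.

Notation deg n := {ffun 'I_n -> int}.

Definition of_deg (k : fieldType) (n : nat) (c : deg n) (p : {mpoly k[n]}) :=
  all (fun m : 'X_{1..n} => [forall i, (m i)%:Z == c i]) (msupp p).

(** A Z^n-graded module over R = k[x_1, ..., x_n] is given by its homogeneous
    components M_a and by the multiplications R_(b - a) x M_a -> M_b, where R_c
    is the space of polynomials satisfying [of_deg c].  The scalar action on M_a
    is that of R_0 = k, by [gactZ] and [gact1]. *)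

Record gmod (k : fieldType) (n : nat) := GMod {
  gcar :> deg n -> lmodType k;
  gact : forall (a b : deg n) (p : {mpoly k[n]}),
    of_deg (b - a) p -> gcar a -> gcar b;
  gact_lin : forall (a b : deg n) p (hp : of_deg (b - a) p), linear (gact hp);
  gact1 : forall (a : deg n) (h : of_deg (a - a) 1) x, gact h x = x;
  gactD : forall (a b : deg n) p q (hp : of_deg (b - a) p) (hq : of_deg (b - a) q)
    (hpq : of_deg (b - a) (p + q)) x, gact hpq x = gact hp x + gact hq x;
  gactZ : forall (a b : deg n) (c : k) p (hp : of_deg (b - a) p)
    (hcp : of_deg (b - a) (c *: p)) x, gact hcp x = c *: gact hp x;
  gactM : forall (a b c : deg n) p q (hp : of_deg (c - b) p) (hq : of_deg (b - a) q)
    (hpq : of_deg (c - a) (p * q)) x, gact hpq x = gact hp (gact hq x) }.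

HB.instance Definition _ k n (M : gmod k n) (a b : deg n) p
    (hp : of_deg (b - a) p) :=
  GRing.isLinear.Build k (M a) (M b) _ (gact hp) (gact_lin hp).

Record nat_hom (k : fieldType) (n : nat) (M N : gmod k n) := NatHom {
  nfun :> forall a : deg n, M a -> N a;
  nfun_lin : forall a, linear (@nfun a);
  nfun_act : forall (a b : deg n) p (hp : of_deg (b - a) p) x,
    nfun (gact hp x) = gact hp (nfun x) }.
Arguments nfun {k n M N}.
Arguments nfun_lin {k n M N}.

HB.instance Definition _ k n (M N : gmod k n) (f : nat_hom M N) a :=
  GRing.isLinear.Build k (M a) (N a) _ (nfun f a) (nfun_lin f a).

Section Morphisms.
Variables (k : fieldType) (n : nat).
Implicit Types M N P : gmod k n.

Lemma nat_hom_ext M N (f g : nat_hom M N) : (forall a, f a =1 g a) -> f = g.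
Proof.
case: f g => [f fl fa] [g gl ga] /= fg.
have {}fg : f = g by apply: functional_extensionality_dep => a; exact: funext.
by subst g; congr NatHom; exact: Prop_irrelevance.
Qed.

Fact comp_lin M N P (g : nat_hom N P) (f : nat_hom M N) a :
  linear (fun x => g a (f a x)).
Proof. by move=> c x y; rewrite !linearP. Qed.

Fact comp_act M N P (g : nat_hom N P) (f : nat_hom M N)
    (a b : deg n) p (hp : of_deg (b - a) p) x :
  g b (f b (gact hp x)) = gact hp (g a (f a x)).
Proof. by rewrite !nfun_act. Qed.

Definition ncomp M N P (g : nat_hom N P) (f : nat_hom M N) : nat_hom M P :=
  NatHom (comp_lin g f) (comp_act g f).

Definition nid M : nat_hom M M :=
  @NatHom k n M M (fun a x => x) (fun a c x y => erefl) (fun a b p hp x => erefl).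

Definition iso M N (f : nat_hom M N) : Prop :=
  exists g : nat_hom N M, ncomp g f = nid M /\ ncomp f g = nid N.

Definition mono M N (f : nat_hom M N) : Prop := forall a, injective (f a).

Definition epi M N (f : nat_hom M N) : Prop := forall a y, exists x, f a x = y.

Definition exact_at M N P (f : nat_hom M N) (g : nat_hom N P) : Prop :=
  forall a y, g a y = 0 <-> exists x, f a x = y.

Definition short_exact M N P (f : nat_hom M N) (g : nat_hom N P) : Prop :=
  [/\ mono f, exact_at f g & epi g].

Definition pointwise_finite_dim M : Prop :=
  forall a, exists (m : nat) (e : 'I_m -> M a),
    forall x, exists c : 'I_m -> k, x = \sum_i c i *: e i.

Definition is_submod M (S : forall a, M a -> Prop) : Prop :=
  [/\ forall a, S a 0,
      forall a x y, S a x -> S a y -> S a (x + y) &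
      forall (a b : deg n) p (hp : of_deg (b - a) p) x, S a x -> S b (gact hp x)].

End Morphisms.

Section Shift.
Variables (k : fieldType) (n : nat) (s : deg n) (M : gmod k n).

Fact shift_homog (a b : deg n) (p : {mpoly k[n]}) :
  of_deg (b - a) p -> of_deg ((s + b) - (s + a)) p.
Proof. by rewrite opprD addrACA subrr add0r. Qed.

Definition shift_act (a b : deg n) (p : {mpoly k[n]}) (hp : of_deg (b - a) p) :
  M (s + a) -> M (s + b) := gact (shift_homog hp).

Fact shift_lin (a b : deg n) p (hp : of_deg (b - a) p) : linear (shift_act hp).
Proof. exact: gact_lin. Qed.

Fact shift1 (a : deg n) (h : of_deg (a - a) 1) x : shift_act h x = x.
Proof. exact: gact1. Qed.

Fact shiftD (a b : deg n) p q (hp : of_deg (b - a) p) (hq : of_deg (b - a) q)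
  (hpq : of_deg (b - a) (p + q)) x :
  shift_act hpq x = shift_act hp x + shift_act hq x.
Proof. exact: gactD. Qed.

Fact shiftZ (a b : deg n) c p (hp : of_deg (b - a) p)
  (hcp : of_deg (b - a) (c *: p)) x :
  shift_act hcp x = c *: shift_act hp x.
Proof. exact: gactZ. Qed.

Fact shiftM (a b c : deg n) p q (hp : of_deg (c - b) p) (hq : of_deg (b - a) q)
  (hpq : of_deg (c - a) (p * q)) x :
  shift_act hpq x = shift_act hp (shift_act hq x).
Proof. exact: gactM. Qed.

Definition shift : gmod k n :=
  @GMod k n (fun d => M (s + d)) shift_act shift_lin shift1 shiftD shiftZ shiftM.

End Shift.

Section NatLmod.
Variables (k : fieldType) (n : nat) (M N : gmod k n).
Implicit Types f g h : nat_hom M N.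

HB.instance Definition _ := gen_eqMixin (nat_hom M N).
HB.instance Definition _ := gen_choiceMixin (nat_hom M N).

Fact nat0_lin a : linear (fun _ : M a => 0 : N a).
Proof. by move=> c x y; rewrite scaler0 addr0. Qed.
Fact nat0_act (a b : deg n) p (hp : of_deg (b - a) p) (x : M a) : 0 = gact hp (0 : N a).
Proof. by rewrite linear0. Qed.
Definition nat0 : nat_hom M N := NatHom nat0_lin nat0_act.

Fact natN_lin f a : linear (fun x => - f a x).
Proof. by move=> c x y; rewrite linearP opprD scalerN. Qed.
Fact natN_act f (a b : deg n) p (hp : of_deg (b - a) p) x :
  - f b (gact hp x) = gact hp (- f a x).
Proof. by rewrite linearN nfun_act. Qed.
Definition natN f : nat_hom M N := NatHom (natN_lin f) (natN_act f).

Fact natD_lin f g a : linear (fun x => f a x + g a x).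
Proof. by move=> c x y; rewrite !linearP scalerDr addrACA. Qed.
Fact natD_act f g (a b : deg n) p (hp : of_deg (b - a) p) x :
  f b (gact hp x) + g b (gact hp x) = gact hp (f a x + g a x).
Proof. by rewrite linearD !nfun_act. Qed.
Definition natD f g : nat_hom M N := NatHom (natD_lin f g) (natD_act f g).

Fact natZ_lin c f a : linear (fun x => c *: f a x).
Proof. by move=> e x y; rewrite linearP scalerDr !scalerA mulrC. Qed.
Fact natZ_act c f (a b : deg n) p (hp : of_deg (b - a) p) x :
  c *: f b (gact hp x) = gact hp (c *: f a x).
Proof. by rewrite linearZ nfun_act. Qed.
Definition natZ c f : nat_hom M N := NatHom (natZ_lin c f) (natZ_act c f).

Fact natDA : associative natD.
Proof. by move=> f g h; apply: nat_hom_ext => a x; exact: addrA. Qed.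
Fact natDC : commutative natD.
Proof. by move=> f g; apply: nat_hom_ext => a x; exact: addrC. Qed.
Fact natD0 : left_id nat0 natD.
Proof. by move=> f; apply: nat_hom_ext => a x; exact: add0r. Qed.
Fact natDN : left_inverse nat0 natN natD.
Proof. by move=> f; apply: nat_hom_ext => a x; exact: addNr. Qed.

HB.instance Definition _ :=
  GRing.isZmodule.Build (nat_hom M N) natDA natDC natD0 natDN.

Fact natZA c e f : natZ c (natZ e f) = natZ (c * e) f.
Proof. by apply: nat_hom_ext => a x; exact: scalerA. Qed.
Fact natZ1 : left_id 1 natZ.
Proof. by move=> f; apply: nat_hom_ext => a x; exact: scale1r. Qed.
Fact natZDr : right_distributive natZ +%R.
Proof. by move=> c f g; apply: nat_hom_ext => a x; exact: scalerDr. Qed.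
Fact natZDl f : {morph natZ^~ f : c e / c + e}.
Proof. by move=> c e; apply: nat_hom_ext => a x; exact: scalerDl. Qed.

HB.instance Definition _ :=
  GRing.Zmodule_isLmodule.Build k (nat_hom M N) natZA natZ1 natZDr natZDl.

End NatLmod.

Section GHom.
Variables (k : fieldType) (n : nat) (M N : gmod k n).

Fact ghom_homog (a b d : deg n) (p : {mpoly k[n]}) :
  of_deg (b - a) p -> of_deg ((b + d) - (a + d)) p.
Proof. by rewrite opprD addrACA subrr addr0. Qed.

Fact ghom_act_lin (a b : deg n) p (hp : of_deg (b - a) p) (f : nat_hom M (shift a N)) d :
  linear (fun x => gact (ghom_homog d hp) (f d x) : shift b N d).
Proof.
move=> c x y; rewrite (nfun_lin f).
exact: (gact_lin (g := N) (ghom_homog d hp)).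
Qed.

Lemma gact_eq (P : gmod k n) (a b : deg n) p q (hp : of_deg (b - a) p)
    (hq : of_deg (b - a) q) (x : P a) : p = q -> gact hp x = gact hq x.
Proof. by move=> e; subst q; congr (gact _ x); exact: Prop_irrelevance. Qed.

Lemma gact_comm (P : gmod k n) (a b b' c : deg n) p q (hp : of_deg (b - a) p)
    (hq : of_deg (c - b) q) (hq' : of_deg (b' - a) q) (hp' : of_deg (c - b') p)
    (x : P a) : gact hq (gact hp x) = gact hp' (gact hq' x).
Proof.
have hM : of_deg (c - a) (q * p).
  apply/allP => m /msuppM_le /allpairsP[[m1 m2] /= [m1q m2p ->]].
  apply/forallP => i; rewrite mnmDE PoszD !ffunE.
  move/allP/(_ _ m1q)/forallP/(_ i): hq; move/allP/(_ _ m2p)/forallP/(_ i): hp.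
  by rewrite !ffunE => /eqP-> /eqP->; rewrite addrA subrK.
have hM' : of_deg (c - a) (p * q) by rewrite mulrC.
rewrite -(gactM hq hp hM) -(gactM hp' hq' hM').
exact/gact_eq/mulrC.
Qed.

Fact ghom_act_act (a b : deg n) p (hp : of_deg (b - a) p) (f : nat_hom M (shift a N))
    (d e : deg n) q (hq : of_deg (e - d) q) x :
  gact (ghom_homog e hp) (f e (gact hq x)) =
  gact (g := shift b N) hq (gact (ghom_homog d hp) (f d x) : shift b N d).
Proof. by rewrite nfun_act; exact: gact_comm. Qed.

Definition ghom_act (a b : deg n) p (hp : of_deg (b - a) p) (f : nat_hom M (shift a N)) :
  nat_hom M (shift b N) := NatHom (ghom_act_lin hp f) (ghom_act_act hp f).

Fact ghom_lin (a b : deg n) p (hp : of_deg (b - a) p) : linear (ghom_act hp).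
Proof. by move=> c f g; apply: nat_hom_ext => d x;
   exact: (gact_lin (g := N) (ghom_homog d hp)). Qed.

Fact ghom1 (a : deg n) (h : of_deg (a - a) 1) x : ghom_act h x = x.
Proof. by apply: nat_hom_ext => d y; exact: (gact1 (g := N)). Qed.

Fact ghomD (a b : deg n) p q (hp : of_deg (b - a) p) (hq : of_deg (b - a) q)
  (hpq : of_deg (b - a) (p + q)) x :
  ghom_act hpq x = ghom_act hp x + ghom_act hq x.
Proof. by apply: nat_hom_ext => d y; exact: (gactD (g := N)). Qed.

Fact ghomZ (a b : deg n) c p (hp : of_deg (b - a) p)
  (hcp : of_deg (b - a) (c *: p)) x :
  ghom_act hcp x = c *: ghom_act hp x.
Proof. by apply: nat_hom_ext => d y; exact: (gactZ (g := N)). Qed.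

Fact ghomM (a b c : deg n) p q (hp : of_deg (c - b) p) (hq : of_deg (b - a) q)
  (hpq : of_deg (c - a) (p * q)) x :
  ghom_act hpq x = ghom_act hp (ghom_act hq x).
Proof. by apply: nat_hom_ext => d y; exact: (gactM (g := N)). Qed.

Definition ghom : gmod k n :=
  @GMod k n (fun a => nat_hom M (shift a N)) ghom_act
    ghom_lin ghom1 ghomD ghomZ ghomM.

End GHom.

Section GHomMap.
Variables (k : fieldType) (n : nat) (M M' N : gmod k n) (f : nat_hom M M').

Fact ghom_map_lin a :
  linear (fun g : nat_hom M' (shift a N) => ncomp g f : nat_hom M (shift a N)).
Proof. by move=> c g h; apply: nat_hom_ext. Qed.

Fact ghom_map_act (a b : deg n) p (hp : of_deg (b - a) p) (g : ghom M' N a) :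
  ncomp (gact hp g : nat_hom M' (shift b N)) f =
  gact (g := ghom M N) hp (ncomp (g : nat_hom M' (shift a N)) f).
Proof. exact: nat_hom_ext. Qed.

Definition ghom_map : nat_hom (ghom M' N) (ghom M N) :=
  @NatHom k n (ghom M' N) (ghom M N) (fun a g => ncomp g f)
    ghom_map_lin ghom_map_act.

End GHomMap.

(** (M (x)_R N)_d is the space of formal sums of symbols x (x) y, with x in M_a
    and y in N_(d - a), modulo biadditivity and p x (x) y = x (x) p y for
    homogeneous p in R (in particular for p in R_0 = k). *)

Record ptens (k : fieldType) (n : nat) (M N : gmod k n) (d : deg n) := PTens {
  pt_deg : deg n;
  pt_left : M pt_deg;
  pt_right : N (d - pt_deg) }.
Arguments PTens {k n M N d}.

Definition tsum (k : fieldType) (n : nat) (M N : gmod k n) (d : deg n) :=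
  seq (ptens M N d).

Section Tensor.
Variables (k : fieldType) (n : nat) (M N : gmod k n).

Fact bal_homog (d a b : deg n) (p : {mpoly k[n]}) :
  of_deg (b - a) p -> of_deg ((d - a) - (d - b)) p.
Proof. by rewrite [X in _ -> of_deg X _]addrC opprB addrA subrK. Qed.

Inductive teq (d : deg n) : tsum M N d -> tsum M N d -> Prop :=
| teq_refl s : teq s s
| teq_sym s t : teq s t -> teq t s
| teq_trans s t u : teq s t -> teq t u -> teq s u
| teq_cat s s' t t' : teq s s' -> teq t t' -> teq (s ++ t) (s' ++ t')
| teq_catC s t : teq (s ++ t) (t ++ s)
| teq_0 a (y : N (d - a)) : teq [:: PTens a 0 y] [::]
| teq_Dl a (x x' : M a) (y : N (d - a)) :
    teq [:: PTens a (x + x') y] [:: PTens a x y; PTens a x' y]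
| teq_Dr a (x : M a) (y y' : N (d - a)) :
    teq [:: PTens a x (y + y')] [:: PTens a x y; PTens a x y']
| teq_bal (a b : deg n) p (hp : of_deg (b - a) p) (x : M a) (y : N (d - b)) :
    teq [:: PTens b (gact hp x) y] [:: PTens a x (gact (bal_homog d hp) y)].

Section Piece.
Variable d : deg n.
Implicit Types s t u : tsum M N d.

HB.instance Definition _ := gen_eqMixin (tsum M N d).
HB.instance Definition _ := gen_choiceMixin (tsum M N d).

Definition teqb s t : bool := `[< teq s t >].

Fact teqb_refl : reflexive teqb.
Proof. by move=> s; apply/asboolP; exact: teq_refl. Qed.
Fact teqb_sym : ssrbool.symmetric teqb.
Proof. by move=> s t; apply/asboolP/asboolP; exact: teq_sym. Qed.
Fact teqb_trans : transitive teqb.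
Proof.
by move=> t s u /asboolP st /asboolP tu; apply/asboolP; exact: teq_trans tu.
Qed.

Canonical teq_equiv := EquivRel teqb teqb_refl teqb_sym teqb_trans.

Definition tens_car := {eq_quot teq_equiv}.

HB.instance Definition _ := Choice.on tens_car.

Definition tclass s : tens_car := \pi_tens_car s.

Lemma tclassP s t : tclass s = tclass t <-> teq s t.
Proof.
split; first by move=> /eqmodP /asboolP.
by move=> st; apply/eqmodP/asboolP.
Qed.

Lemma tclassW (P : tens_car -> Prop) : (forall s, P (tclass s)) -> forall x, P x.
Proof. by move=> h x; rewrite -[x]reprK; exact: h. Qed.

Lemma repr_tclass s : teq (repr (tclass s)) s.
Proof. by apply/tclassP; rewrite /tclass reprK. Qed.

Definition tscale_sum (c : k) s : tsum M N d :=
  map (fun g => PTens (pt_deg g) (c *: pt_left g) (pt_right g)) s.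

Lemma teq_scale c s t : teq s t -> teq (tscale_sum c s) (tscale_sum c t).
Proof.
elim=> {s t} /=.
- by move=> s; exact: teq_refl.
- by move=> s t _; exact: teq_sym.
- by move=> s t u _ h1 _; exact: teq_trans.
- by move=> s s' t t' _ h1 _ h2; rewrite /tscale_sum !map_cat; exact: teq_cat.
- by move=> s t; rewrite /tscale_sum !map_cat; exact: teq_catC.
- by move=> a y; rewrite scaler0; exact: teq_0.
- by move=> a x x' y; rewrite scalerDr; exact: teq_Dl.
- by move=> a x y y'; exact: teq_Dr.
- by move=> a b p hp x y; rewrite -linearZ; exact: teq_bal.
Qed.

Definition tadd (x y : tens_car) : tens_car := tclass (repr x ++ repr y).
Definition tscale (c : k) (x : tens_car) : tens_car :=
  tclass (tscale_sum c (repr x)).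
Definition tzero : tens_car := tclass [::].
Definition topp (x : tens_car) : tens_car := tscale (-1) x.

Lemma tadd_class s t : tadd (tclass s) (tclass t) = tclass (s ++ t).
Proof. by apply/tclassP/teq_cat; exact: repr_tclass. Qed.
Lemma tscale_class c s : tscale c (tclass s) = tclass (tscale_sum c s).
Proof. by apply/tclassP/teq_scale; exact: repr_tclass. Qed.

Lemma tscale_sumDl c e s :
  teq (tscale_sum (c + e) s) (tscale_sum c s ++ tscale_sum e s).
Proof.
elim: s => [|[a x y] s IH] /=; first exact: teq_refl.
rewrite scalerDl.
apply: (teq_trans (t := [:: PTens a (c *: x) y; PTens a (e *: x) y] ++
                        (tscale_sum c s ++ tscale_sum e s))).
  by rewrite -cat1s; apply: teq_cat IH; exact: teq_Dl.
rewrite -cat1s -[_ :: tscale_sum c s ++ _]cat1s -catA.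
apply: teq_cat; first exact: teq_refl.
rewrite -[_ :: tscale_sum e s]cat1s !catA.
by apply: teq_cat; [exact: teq_catC | exact: teq_refl].
Qed.

Lemma tscale_sum0 s : teq (tscale_sum 0 s) [::].
Proof.
elim: s => [|[a x y] s IH] /=; first exact: teq_refl.
by rewrite scale0r -cat1s -[[::]]cats0; apply: teq_cat IH; exact: teq_0.
Qed.

Lemma tscale_sum1 s : tscale_sum 1 s = s.
Proof. by elim: s => [|[a x y] s /= ->] //=; rewrite scale1r. Qed.

Fact taddA : associative tadd.
Proof.
elim/tclassW=> s; elim/tclassW=> t; elim/tclassW=> u.
by rewrite !tadd_class catA.
Qed.
Fact taddC : commutative tadd.
Proof.
elim/tclassW=> s; elim/tclassW=> t; rewrite !tadd_class.
by apply/tclassP; exact: teq_catC.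
Qed.
Fact tadd0 : left_id tzero tadd.
Proof. by elim/tclassW=> s; rewrite tadd_class. Qed.
Fact taddN : left_inverse tzero topp tadd.
Proof.
elim/tclassW=> s; rewrite /topp tscale_class tadd_class; apply/tclassP.
rewrite -[X in _ ++ X]tscale_sum1.
apply: teq_trans (teq_sym (tscale_sumDl _ _ _)) _.
by rewrite addNr; exact: tscale_sum0.
Qed.

HB.instance Definition _ := GRing.isZmodule.Build tens_car taddA taddC tadd0 taddN.

Fact tscaleA c e x : tscale c (tscale e x) = tscale (c * e) x.
Proof.
elim/tclassW: x => s; rewrite !tscale_class; congr tclass.
by rewrite /tscale_sum -map_comp; apply: eq_map => g /=; rewrite scalerA.
Qed.
Fact tscale1 : left_id 1 tscale.
Proof. by elim/tclassW=> s; rewrite tscale_class tscale_sum1. Qed.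
Fact tscaleDr : right_distributive tscale +%R.
Proof.
move=> c; elim/tclassW=> s; elim/tclassW=> t.
rewrite /GRing.add /= tadd_class !tscale_class tadd_class.
by rewrite /tscale_sum map_cat.
Qed.
Fact tscaleDl x : {morph tscale^~ x : c e / c + e}.
Proof.
elim/tclassW: x => s c e; rewrite [RHS]/GRing.add /= !tscale_class tadd_class.
by apply/tclassP; exact: tscale_sumDl.
Qed.

HB.instance Definition _ :=
  GRing.Zmodule_isLmodule.Build k tens_car tscaleA tscale1 tscaleDr tscaleDl.

Lemma add_tclass s t : tclass s + tclass t = tclass (s ++ t).
Proof. exact: tadd_class. Qed.
Lemma scale_tclass c s : c *: tclass s = tclass (tscale_sum c s).
Proof. exact: tscale_class. Qed.

End Piece.

Fact tens_homog (d e a : deg n) (p : {mpoly k[n]}) :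
  of_deg (e - d) p -> of_deg ((e - a) - (d - a)) p.
Proof. by rewrite opprB addrA subrK. Qed.

Definition tact_sum (d e : deg n) p (hp : of_deg (e - d) p) (s : tsum M N d) : tsum M N e :=
  map (fun g => PTens (pt_deg g) (pt_left g)
                  (gact (tens_homog (pt_deg g) hp) (pt_right g))) s.

Lemma teq_act (d e : deg n) p (hp : of_deg (e - d) p) s t :
  teq s t -> teq (tact_sum hp s) (tact_sum hp t).
Proof.
elim=> {s t} /=.
- by move=> s; exact: teq_refl.
- by move=> s t _; exact: teq_sym.
- by move=> s t u _ h1 _; exact: teq_trans.
- by move=> s s' t t' _ h1 _ h2; rewrite /tact_sum !map_cat; exact: teq_cat.
- by move=> s t; rewrite /tact_sum !map_cat; exact: teq_catC.
- by move=> a y; exact: teq_0.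
- by move=> a x x' y; exact: teq_Dl.
- by move=> a x y y'; rewrite linearD; exact: teq_Dr.
- move=> a b q hq x y; apply: teq_trans (teq_bal hq x _) _.
  by rewrite (gact_comm _ _ (bal_homog d hq) (tens_homog a hp)); exact: teq_refl.
Qed.

Definition tact (d e : deg n) p (hp : of_deg (e - d) p) (x : tens_car d) : tens_car e :=
  tclass (tact_sum hp (repr x)).

Lemma tact_class (d e : deg n) p (hp : of_deg (e - d) p) s :
  tact hp (tclass s) = tclass (tact_sum hp s).
Proof. by apply/tclassP/teq_act; exact: repr_tclass. Qed.

Fact tact_lin (d e : deg n) p (hp : of_deg (e - d) p) : linear (tact hp).
Proof.
move=> c; elim/tclassW=> s; elim/tclassW=> t.
rewrite scale_tclass add_tclass !tact_class scale_tclass add_tclass.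
rewrite /tact_sum /tscale_sum map_cat -!map_comp.
by congr (tclass (_ ++ _)).
Qed.

Fact tact1 (a : deg n) (h : of_deg (a - a) 1) x : tact h x = x.
Proof.
elim/tclassW: x => s; rewrite tact_class; congr tclass.
elim: s => [|[b x y] s /= ->] //; congr (PTens _ _ _ :: _).
exact: gact1.
Qed.

Fact tactD (d e : deg n) p q (hp : of_deg (e - d) p) (hq : of_deg (e - d) q)
  (hpq : of_deg (e - d) (p + q)) x : tact hpq x = tact hp x + tact hq x.
Proof.
elim/tclassW: x => s; rewrite !tact_class add_tclass.
apply/tclassP; elim: s => [|[a x y] s IH] /=; first exact: teq_refl.
rewrite (gactD (tens_homog a hp) (tens_homog a hq)).
set z := gact _ y; set z' := gact _ y.
apply: (teq_trans (t := [:: PTens a x z; PTens a x z'] ++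
                        (tact_sum hp s ++ tact_sum hq s))).
  by rewrite -cat1s; apply: teq_cat IH; exact: teq_Dr.
rewrite -cat1s -[_ :: tact_sum hp s ++ _]cat1s -catA.
apply: teq_cat; first exact: teq_refl.
rewrite -[_ :: tact_sum hq s]cat1s !catA.
by apply: teq_cat; [exact: teq_catC | exact: teq_refl].
Qed.

Lemma homogC (c : k) (a : deg n) : of_deg (a - a) (c *: 1 : {mpoly k[n]}).
Proof.
apply/allP => m /msuppZ_le; rewrite msupp1 inE => /eqP->.
by apply/forallP => i; rewrite subrr ffunE mnm0E.
Qed.

Lemma homog1 (a : deg n) : of_deg (a - a) (1 : {mpoly k[n]}).
Proof. by have := homogC 1 a; rewrite scale1r. Qed.

Lemma teq_scaler d c a (x : M a) (y : N (d - a)) :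
  teq [:: PTens a (c *: x) y] [:: PTens a x (c *: y)].
Proof.
have h := homogC c a.
have := teq_bal h x y.
by rewrite !(gactZ (homog1 _)) !gact1.
Qed.

Fact tactZ (d e : deg n) c p (hp : of_deg (e - d) p)
  (hcp : of_deg (e - d) (c *: p)) x :
  tact hcp x = c *: tact hp x.
Proof.
elim/tclassW: x => s; rewrite !tact_class scale_tclass.
apply/tclassP; elim: s => [|[a x y] s IH] /=; first exact: teq_refl.
rewrite -cat1s -[X in teq _ X]cat1s; apply: teq_cat IH.
rewrite (gactZ (tens_homog a hp)).
by apply: teq_sym; exact: teq_scaler.
Qed.

Fact tactM (a b c : deg n) p q (hp : of_deg (c - b) p) (hq : of_deg (b - a) q)
  (hpq : of_deg (c - a) (p * q)) x : tact hpq x = tact hp (tact hq x).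
Proof.
elim/tclassW: x => s; rewrite !tact_class; congr tclass.
rewrite /tact_sum -map_comp; apply: eq_map => g /=.
by congr (PTens _ _ _); exact: gactM.
Qed.

Definition tens : gmod k n :=
  @GMod k n tens_car tact tact_lin tact1 tactD tactZ tactM.

End Tensor.

Section TensorMap.
Variables (k : fieldType) (n : nat) (F M N : gmod k n) (f : nat_hom M N).

Definition tmap_sum d (s : tsum F M d) : tsum F N d :=
  map (fun g => PTens (pt_deg g) (pt_left g) (f _ (pt_right g))) s.

Lemma teq_map d (s t : tsum F M d) :
  teq s t -> teq (tmap_sum s) (tmap_sum t).
Proof.
elim=> {s t} /=.
- by move=> s; exact: teq_refl.
- by move=> s t _; exact: teq_sym.
- by move=> s t u _ h1 _; exact: teq_trans.
- by move=> s s' t t' _ h1 _ h2; rewrite /tmap_sum !map_cat; exact: teq_cat.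
- by move=> s t; rewrite /tmap_sum !map_cat; exact: teq_catC.
- by move=> a y; exact: teq_0.
- by move=> a x x' y; exact: teq_Dl.
- by move=> a x y y'; rewrite linearD; exact: teq_Dr.
- by move=> a b q hq x y; rewrite nfun_act; exact: teq_bal.
Qed.

Definition tmap d (x : tens_car F M d) : tens_car F N d :=
  tclass (tmap_sum (repr x)).

Lemma tmap_class d (s : tsum F M d) : tmap (tclass s) = tclass (tmap_sum s).
Proof. by apply/tclassP/teq_map; exact: repr_tclass. Qed.

Fact tmap_lin d : linear (@tmap d).
Proof.
move=> c; elim/tclassW=> s; elim/tclassW=> t.
rewrite scale_tclass add_tclass !tmap_class scale_tclass add_tclass.
rewrite /tmap_sum /tscale_sum map_cat -!map_comp.
by congr (tclass (_ ++ _)).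
Qed.

Fact tmap_act (a b : deg n) p (hp : of_deg (b - a) p) (x : tens F M a) :
  tmap (gact hp x) = gact (g := tens F N) hp (tmap x).
Proof.
elim/tclassW: x => s; rewrite /= tact_class !tmap_class tact_class.
congr tclass; rewrite /tmap_sum /tact_sum -!map_comp; apply: eq_map => g /=.
by rewrite nfun_act.
Qed.

Definition tens_map : nat_hom (tens F M) (tens F N) :=
  @NatHom k n (tens F M) (tens F N) tmap tmap_lin tmap_act.

End TensorMap.

Section Image.
Variables (k : fieldType) (n : nat) (M N : gmod k n) (f : nat_hom M N).

Definition im_pred (a : deg n) : {pred N a} := [pred y | `[< exists x, f a x = y >]].
Arguments im_pred : clear implicits.

Fact im_submod a : submod_closed (im_pred a).
Proof.
split; first by apply/asboolP; exists 0; rewrite linear0.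
move=> c _ _ /asboolP[x <-] /asboolP[y <-].
by apply/asboolP; exists (c *: x + y); rewrite linearP.
Qed.

HB.instance Definition _ a :=
  GRing.isSubmodClosed.Build k (N a) (im_pred a) (im_submod a).

Definition im_car a := {y : N a | y \in im_pred a}.

HB.instance Definition _ a := SubChoice.on (im_car a).
HB.instance Definition _ a := [SubChoice_isSubLmodule of im_car a by <:].

Fact im_actP (a b : deg n) p (hp : of_deg (b - a) p) (y : im_car a) :
  gact hp (val y) \in im_pred b.
Proof.
case: y => y /= /asboolP[x e]; apply/asboolP; rewrite -{}e.
by exists (gact hp x); rewrite nfun_act.
Qed.

Definition im_act (a b : deg n) p (hp : of_deg (b - a) p) (y : im_car a) : im_car b :=
  Sub (gact hp (val y)) (im_actP hp y).

Fact im_act_lin (a b : deg n) p (hp : of_deg (b - a) p) : linear (im_act hp).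
Proof. by move=> c x y; apply: val_inj; rewrite /= !linearP. Qed.

Fact im_act1 (a : deg n) (h : of_deg (a - a) 1) x : im_act h x = x.
Proof. by apply: val_inj; exact: gact1. Qed.

Fact im_actD (a b : deg n) p q (hp : of_deg (b - a) p) (hq : of_deg (b - a) q)
  (hpq : of_deg (b - a) (p + q)) x : im_act hpq x = im_act hp x + im_act hq x.
Proof. by apply: val_inj; exact: gactD. Qed.

Fact im_actZ (a b : deg n) c p (hp : of_deg (b - a) p)
  (hcp : of_deg (b - a) (c *: p)) x :
  im_act hcp x = c *: im_act hp x.
Proof. by apply: val_inj; exact: gactZ. Qed.

Fact im_actM (a b c : deg n) p q (hp : of_deg (c - b) p) (hq : of_deg (b - a) q)
  (hpq : of_deg (c - a) (p * q)) x : im_act hpq x = im_act hp (im_act hq x).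
Proof. by apply: val_inj; exact: gactM. Qed.

Definition im : gmod k n :=
  @GMod k n im_car im_act im_act_lin im_act1 im_actD im_actZ im_actM.

Fact im_incl_lin a : linear (fun y : im_car a => val y).
Proof. by move=> c x y; rewrite linearP. Qed.

Definition im_incl : nat_hom im N :=
  @NatHom k n im N (fun a y => val y) im_incl_lin (fun a b p hp y => erefl).

Fact im_projP a (x : M a) : f a x \in im_pred a.
Proof. by apply/asboolP; exists x. Qed.

Definition im_proj_fun a (x : M a) : im_car a := Sub (f a x) (im_projP x).

Fact im_proj_lin a : linear (@im_proj_fun a).
Proof. by move=> c x y; apply: val_inj; rewrite /= linearP. Qed.

Fact im_proj_act (a b : deg n) p (hp : of_deg (b - a) p) (x : M a) :
  im_proj_fun (gact hp x) = gact (g := im) hp (im_proj_fun x).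
Proof. by apply: val_inj; rewrite /= nfun_act. Qed.

Definition im_proj : nat_hom M im :=
  @NatHom k n M im im_proj_fun im_proj_lin im_proj_act.

End Image.

(** The module k = R / <x_1, ..., x_n>: one-dimensional in degree 0 and zero in
    the other degrees ('rV_0 is the zero space), a polynomial acting through
    its constant term. *)

Section Residue.
Variables (k : fieldType) (n : nat).

Definition res_car (a : deg n) := 'rV[k]_(a == 0).

Definition res_act (a b : deg n) (p : {mpoly k[n]}) (hp : of_deg (b - a) p)
  (v : res_car a) : res_car b := p@_0 *: (v *m pid_mx 1).

Lemma res_pid (b : bool) : pid_mx 1 = 1%:M :> 'M[k]_b.
Proof. by case: b; [exact: pid_mx_1 | rewrite [LHS]flatmx0 [RHS]flatmx0]. Qed.

Fact res_lin (a b : deg n) p (hp : of_deg (b - a) p) : linear (res_act hp).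
Proof.
move=> c x y; rewrite /res_act mulmxDl -scalemxAl scalerDr !scalerA.
by rewrite mulrC.
Qed.

Fact res1 (a : deg n) (h : of_deg (a - a) 1) x : res_act h x = x.
Proof.
by rewrite /res_act mcoeff1 eqxx scale1r res_pid mulmx1.
Qed.

Fact resD (a b : deg n) p q (hp : of_deg (b - a) p) (hq : of_deg (b - a) q)
  (hpq : of_deg (b - a) (p + q)) x : res_act hpq x = res_act hp x + res_act hq x.
Proof. by rewrite /res_act mcoeffD scalerDl. Qed.

Fact resZ (a b : deg n) c p (hp : of_deg (b - a) p)
  (hcp : of_deg (b - a) (c *: p)) x :
  res_act hcp x = c *: res_act hp x.
Proof. by rewrite /res_act mcoeffZ scalerA. Qed.

Lemma homog_coef0 (c : deg n) (p : {mpoly k[n]}) :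
  of_deg c p -> c != 0 -> p@_0 = 0.
Proof.
move=> /allP hp c0; apply/eqP; rewrite mcoeff_eq0; apply: contra c0 => /hp.
by move=> /forallP h; apply/eqP/ffunP => i; rewrite ffunE -(eqP (h i)) mnm0E.
Qed.

Fact resM (a b c : deg n) p q (hp : of_deg (c - b) p) (hq : of_deg (b - a) q)
  (hpq : of_deg (c - a) (p * q)) x : res_act hpq x = res_act hp (res_act hq x).
Proof.
rewrite /res_act; have -> : (p * q)@_0 = p@_0 * q@_0 by rewrite rmorphM.
have [e|ne] := eqVneq b a; last first.
  rewrite -subr_eq0 in ne.
  by rewrite (homog_coef0 hq ne) mulr0 !scale0r mul0mx scaler0.
rewrite -scalemxAl scalerA -mulmxA; congr (_ *: (_ *m _)).
by rewrite {hp hq hpq} e res_pid mul1mx.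
Qed.

Definition residue : gmod k n :=
  @GMod k n res_car res_act res_lin res1 resD resZ resM.

End Residue.

Section Homological.
Variables (k : fieldType) (n : nat).
Implicit Types M N E F : gmod k n.

Definition flat_gmod F : Prop :=
  forall A B C (f : nat_hom A B) (g : nat_hom B C), short_exact f g ->
    short_exact (tens_map F f) (tens_map F g).

Definition injective_gmod E : Prop :=
  forall A B C (f : nat_hom A B) (g : nat_hom B C), short_exact f g ->
    short_exact (ghom_map E g) (ghom_map E f).

Definition injective_hull M E (i : nat_hom M E) : Prop :=
  [/\ mono i, injective_gmod E &
    forall S : forall a, E a -> Prop, is_submod S ->
      (exists a x, S a x /\ x != 0) ->
      exists a m, S a (i a m) /\ i a m != 0].

Definition flat_precover F M (f : nat_hom F M) : Prop :=
  flat_gmod F /\ forall F' (g : nat_hom F' M), flat_gmod F' ->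
    exists h : nat_hom F' F, ncomp f h = g.

Definition flat_cover F M (f : nat_hom F M) : Prop :=
  flat_precover f /\ forall h : nat_hom F F, ncomp f h = f -> iso h.

(* 0 -> M -> E^0 -> E^1 -> ..., with augmentation eps = d^(-1) *)
Definition coresolution M (E : nat -> gmod k n) (eps : nat_hom M (E 0%N))
    (d : forall i, nat_hom (E i) (E i.+1)) : Prop :=
  [/\ mono eps, exact_at eps (d 0%N) & forall i, exact_at (d i) (d i.+1)].

Definition minimal_injective_resolution M (E : nat -> gmod k n)
    (eps : nat_hom M (E 0%N)) (d : forall i, nat_hom (E i) (E i.+1)) : Prop :=
  [/\ coresolution eps d, injective_hull (im_incl eps) &
      forall i, injective_hull (im_incl (d i))].

(* ... -> F_1 -> F_0 -> M -> 0; here d i : F_(i+1) -> F_i stands for d_(i+1)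
   and the augmentation eps for d_0. *)
Definition resolution M (F : nat -> gmod k n) (eps : nat_hom (F 0%N) M)
    (d : forall i, nat_hom (F i.+1) (F i)) : Prop :=
  [/\ epi eps, exact_at (d 0%N) eps & forall i, exact_at (d i.+1) (d i)].

Definition minimal_flat_resolution M (F : nat -> gmod k n)
    (eps : nat_hom (F 0%N) M) (d : forall i, nat_hom (F i.+1) (F i)) : Prop :=
  [/\ resolution eps d, flat_cover (im_proj eps) &
      forall i, flat_cover (im_proj (d i))].

End Homological.

(** The Matlis dual Hom(M, E(k)) when Ek is an injective hull of [residue k n] *)

Definition matlis (k : fieldType) (n : nat) (Ek M : gmod k n) : gmod k n :=
  ghom M Ek.

Definition matlis_map (k : fieldType) (n : nat) (Ek M N : gmod k n)
    (f : nat_hom M N) : nat_hom (matlis Ek N) (matlis Ek M) := ghom_map Ek f.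

(* Main.v *)
(** Homogeneous ideals of [R] are monomial, so a graded module is a functor from
    the poset [Z^n], and Dickson's lemma makes everything finitary.  Since [Ek] is
    the injective hull of [k], a morphism [M -> Ek(b)] amounts to a functional on
    [M_(-b)].

    A module [F] is flat iff its dual is injective, by adjunction.  By Baer's
    criterion [E] is injective iff finitely many exactness conditions between its
    components hold; these are preserved and reflected by double duals of vector
    spaces, so [E] is injective iff its dual is flat, without finiteness hypothesis.

    If [i : M -> E] is an injective hull, its dual is a precover by transposition.
    Let [h] be an endomorphism of the dual of [E] compatible with the dual of [i].
    Essentiality of [M] and maximality of an annihilator show that [h] is
    injective, even modulo each monomial ideal; hence the kernel of its dual is
    injective and [h] has a retraction, which can be corrected to be compatible
    with the dual of [i], hence to be injective, so that [h] is an isomorphism.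
    The converse, and the passage from hulls and covers to resolutions, are formal;
    the second part follows from the first by biduality. *)

From HB Require Import structures.
Require Import Defs.
From mathcomp Require Import all_boot all_order all_algebra.
From mathcomp Require Import boolp.
From mathcomp Require classical_sets.
From mathcomp.multinomials Require Import mpoly.

Set Implicit Arguments.
Unset Strict Implicit.
Unset Printing Implicit Defensive.

Import Order.TTheory GRing.Theory Num.Theory.
Local Open Scope ring_scope.
Local Open Scope quotient_scope.

(** * Graded modules as functors on [Z^n] *)

Section DegreeOrder.
Variable n : nat.
Implicit Types a b c d : deg n.

Definition dle a b : bool := [forall i, a i <= b i].

Lemma dleP a b : reflect (forall i, a i <= b i) (dle a b).
Proof. exact: forallP. Qed.

Lemma dle_refl a : dle a a.
Proof. by apply/dleP. Qed.

Lemma dle_trans b a c : dle a b -> dle b c -> dle a c.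
Proof. by move=> /dleP h /dleP h'; apply/dleP => i; exact: le_trans (h' i). Qed.

Lemma dle_anti a b : dle a b -> dle b a -> a = b.
Proof.
move=> /dleP h /dleP h'; apply/ffunP => i.
by apply/eqP; rewrite eq_le h h'.
Qed.

Lemma dle_add2l c a b : dle (c + a) (c + b) = dle a b.
Proof. by apply: eq_forallb => i; rewrite !ffunE lerD2l. Qed.

Lemma dle_add2r c a b : dle (a + c) (b + c) = dle a b.
Proof. by rewrite ![_ + c]addrC dle_add2l. Qed.

Lemma dleN a b : dle (- a) (- b) = dle b a.
Proof. by apply: eq_forallb => i; rewrite !ffunE lerN2. Qed.

Definition dmax a b : deg n := [ffun i => Num.max (a i) (b i)].

Lemma dle_maxl a b : dle a (dmax a b).
Proof. by apply/dleP => i; rewrite ffunE le_max lexx. Qed.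

Lemma dle_maxr a b : dle b (dmax a b).
Proof. by apply/dleP => i; rewrite ffunE le_max lexx orbT. Qed.

Lemma dmax_lub a b c : dle a c -> dle b c -> dle (dmax a b) c.
Proof.
by move=> /dleP h /dleP h'; apply/dleP => i; rewrite ffunE ge_max h h'.
Qed.

End DegreeOrder.
#[local] Hint Resolve dle_refl : core.

(** * Homogeneous polynomials as scalar multiples of monomials *)

Section Monomials.
Variables (k : fieldType) (n : nat).
Implicit Types (a b c d : deg n) (p q : {mpoly k[n]}).

(** On a homogeneous polynomial this value is its only possible coefficient. *)
Definition ev1 p : k := p.@[fun _ => 1].

Definition mon a b : {mpoly k[n]} :=
  if dle a b then 'X_[ [multinom absz ((b - a)%R i) | i < n] ] else 0.

Lemma monP a b : of_deg (b - a) (mon a b).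
Proof.
rewrite /mon; case: (boolP (dle a b)) => [/dleP h|_]; last by rewrite /of_deg msupp0.
rewrite /of_deg msuppX /= andbT; apply/forallP => i.
by rewrite mnmE gez0_abs // !ffunE subr_ge0.
Qed.

Lemma of_deg_mon a b p : of_deg (b - a) p -> p = ev1 p *: mon a b.
Proof.
move=> /allP hp; rewrite /mon; case: (boolP (dle a b)) => [ab|nab]; last first.
  rewrite scaler0; apply/eqP; rewrite -msupp_eq0; apply/eqP.
  case e: (msupp p) hp => [//|m s] /(_ m (mem_head _ _)) /forallP h; case/negP: nab.
  by apply/dleP => i; rewrite -subr_ge0; have := eqP (h i); rewrite !ffunE => <-.
set m0 := [multinom _ | _ < _].
(* The degree determines the exponent, so at most one monomial occurs in [p]. *)
have sp m : m \in msupp p -> m = m0.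
  move=> /hp /forallP h; apply/mnmP => i; rewrite mnmE.
  by rewrite -(eqP (h i)).
have e : p = p@_m0 *: 'X_[m0].
  rewrite [LHS]mpolyE; have [mp|mp] := boolP (m0 \in msupp p).
    rewrite (big_rem _ mp) /= [X in _ + X]big_seq big1 ?addr0 // => m mr.
    move: (mem_rem mr) => /sp em; move: mr.
    by rewrite em mem_rem_uniqF // msupp_uniq.
  rewrite (memN_msupp_eq0 mp) scale0r big_seq big1 // => m mm.
  by move: (mm) mp; rewrite {1}(sp m mm) => ->.
by rewrite [in ev1 p]e /ev1 mevalZ mevalX big1 ?mulr1 // => i _; rewrite expr1n.
Qed.

Lemma ev1_mon a b : dle a b -> ev1 (mon a b) = 1.
Proof.
by move=> ab; rewrite /mon ab /ev1 mevalX big1 // => i _; rewrite expr1n.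
Qed.

Lemma ev1_nle a b p : of_deg (b - a) p -> ~~ dle a b -> ev1 p = 0.
Proof.
move=> /of_deg_mon -> /negPf; rewrite /mon => ->.
by rewrite scaler0 /ev1 meval0.
Qed.

Lemma mon_mul a b c : dle a b -> dle b c -> mon a c = mon b c * mon a b.
Proof.
move=> ab bc; rewrite /mon ab bc (dle_trans ab bc) -mpolyXD.
congr mpolyX; apply/mnmP => i; rewrite mnmDE !mnmE !ffunE.
move/dleP: ab => /(_ i) ab; move/dleP: bc => /(_ i) bc.
apply/eqP; rewrite -(eqr_nat int) natrD !natz !gez0_abs ?subr_ge0 ?(le_trans ab bc) //.
by rewrite addrA subrK.
Qed.

Lemma mon_id a : mon a a = 1.
Proof.
rewrite /mon dle_refl; rewrite -mpolyX0; congr mpolyX.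
by apply/mnmP => i; rewrite !mnmE subrr ffunE.
Qed.

Lemma mon_shift a b c d : b - a = d - c -> mon a b = mon c d.
Proof.
move=> e; rewrite /mon e; congr (if _ then _ else _).
by rewrite -[LHS](dle_add2r (- a)) -[RHS](dle_add2r (- c)) !subrr e.
Qed.

End Monomials.

Section MonomialAction.
Variables (k : fieldType) (n : nat).
Implicit Types (a b c d : deg n) (M N : gmod k n).

(** Multiplication by [x^(b - a)], and zero unless [a <= b].  When [a = b] only
    propositionally it also serves as a cast from [M a] to [M b]. *)
Definition mact M a b : M a -> M b := gact (monP k a b).
Arguments mact M : clear implicits.

HB.instance Definition _ M a b := GRing.Linear.copy (mact M a b) (gact (monP k a b)).

Lemma gactE M a b p (hp : of_deg (b - a) p) (x : M a) :
  gact hp x = ev1 p *: mact M a b x.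
Proof.
have hq : of_deg (b - a) (ev1 p *: mon k a b) by rewrite -of_deg_mon.
rewrite -(gactZ (monP k a b) hq); exact/gact_eq/of_deg_mon.
Qed.

Lemma mact_id M a x : mact M a a x = x.
Proof.
have h : of_deg (a - a) (1 : {mpoly k[n]}) by exact: homog1.
by rewrite -[RHS](gact1 h); apply: gact_eq; exact: mon_id.
Qed.

Lemma mactZ M a b (c : k) x : mact M a b (c *: x) = c *: mact M a b x.
Proof. exact: linearZ. Qed.

Lemma mact_nle M a b x : ~~ dle a b -> mact M a b x = 0.
Proof.
move=> nab; rewrite /mact gactE.
by rewrite /mon (negPf nab) /ev1 meval0 scale0r.
Qed.

Lemma mact_comp M a b c x : dle a b -> dle b c ->
  mact M b c (mact M a b x) = mact M a c x.
Proof.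
move=> ab bc; have h : of_deg (c - a) (mon k b c * mon k a b).
  by rewrite -mon_mul //; exact: monP.
rewrite /mact -(gactM (monP k b c) (monP k a b) h). exact/gact_eq/esym/mon_mul.
Qed.

Lemma nfun_mact M N (f : nat_hom M N) a b x : f b (mact M a b x) = mact N a b (f a x).
Proof. exact: nfun_act. Qed.

Lemma mact_castK M a b (e : a = b) (x : M a) : mact M b a (mact M a b x) = x.
Proof. by rewrite mact_comp ?mact_id // e. Qed.

Lemma mact_shift s M a b x : mact (shift s M) a b x = mact M (s + a) (s + b) x.
Proof.
apply: (gact_eq (P := M) (shift_homog s (monP k a b)) (monP k (s + a) (s + b))).
by apply: mon_shift; rewrite opprD addrACA subrr add0r.
Qed.

Lemma mact_ghom M N a b (f : ghom M N a) d x :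
  (mact (ghom M N) a b f : nat_hom _ _) d x = mact N (a + d) (b + d) ((f : nat_hom _ _) d x).
Proof.
apply: (gact_eq (P := N) (ghom_homog d (monP k a b)) (monP k (a + d) (b + d))).
by apply: mon_shift; rewrite opprD addrACA subrr addr0.
Qed.

(** Scalars are the constant polynomials, which act in degree 0; this supplies the scalar
    closure. *)
Lemma submod_closed_of M (S : forall a, M a -> Prop) : is_submod S ->
  forall a, submod_closed [pred x : M a | `[< S a x >]].
Proof.
case=> S0 SD Sa a; split; first by rewrite inE; apply/asboolP.
move=> c x y; rewrite !inE => /asboolP hx /asboolP hy; apply/asboolP/SD => //.
have h := homogC c a; have -> : c *: x = gact h x; last exact: Sa.
by rewrite gactE mact_id /ev1 mevalZ meval1 mulr1.
Qed.

Lemma submodZ M (S : forall a, M a -> Prop) : is_submod S ->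
  forall a (c : k) x, S a x -> S a (c *: x).
Proof.
move=> hS a c x Sx; have [S0 SD _] := hS.
have [z h] := submod_closed_of hS a.
have := h c x 0; rewrite addr0 !inE => h'; apply/asboolP/h' => //; exact/asboolP.
Qed.

Lemma is_submodP M (S : forall a, M a -> Prop) :
  (forall a, S a 0) -> (forall a (c : k) x y, S a x -> S a y -> S a (c *: x + y)) ->
  (forall a b x, dle a b -> S a x -> S b (mact M a b x)) -> is_submod S.
Proof.
move=> S0 SP Sm; split => //.
- by move=> a x y hx hy; rewrite -[x]scale1r; exact: SP.
- move=> a b p hp x Sx; rewrite gactE -[_ *: _]addr0; apply: SP => //.
  by have [ab|ab] := boolP (dle a b); [exact: Sm|rewrite mact_nle].
Qed.

Lemma nat_hom_mactP M N (f : forall a, M a -> N a) : (forall a, linear (f a)) ->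
  (forall a b x, dle a b -> f b (mact M a b x) = mact N a b (f a x)) ->
  forall (a b : deg n) p (hp : of_deg (b - a) p) x, f b (gact hp x) = gact hp (f a x).
Proof.
move=> fl fa a b p hp x.
pose g := HB.pack (f b) (GRing.isLinear.Build k (M b) (N b) _ (f b) (fl b)) : {linear M b -> N b}.
rewrite !gactE -[f b]/(g : _ -> _) linearZ /=; congr (_ *: _).
have [ab|ab] := boolP (dle a b); first exact: fa.
by rewrite !mact_nle // -[f b]/(g : _ -> _) linear0.
Qed.

Definition nat_homB M N (f : forall a, M a -> N a) (fl : forall a, linear (f a))
  (fa : forall a b x, dle a b -> f b (mact M a b x) = mact N a b (f a x)) : nat_hom M N :=
  NatHom fl (nat_hom_mactP fl fa).

End MonomialAction.
Arguments mact {k n} M a b.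

(** A functor from the poset [Z^n] to vector spaces, seen as a graded module. *)
Section PosetModule.
Variables (k : fieldType) (n : nat) (V : deg n -> lmodType k).
Variable u : forall a b : deg n, {linear V a -> V b}.
Hypothesis u_id : forall a x, u a a x = x.
Hypothesis u_comp : forall a b c x, dle a b -> dle b c -> u b c (u a b x) = u a c x.

Definition poset_act (a b : deg n) (p : {mpoly k[n]}) (hp : of_deg (b - a) p) (x : V a) : V b :=
  ev1 p *: u a b x.

Fact poset_act_lin (a b : deg n) p (hp : of_deg (b - a) p) : linear (poset_act hp).
Proof.
by move=> c x y; rewrite /poset_act linearP scalerDr !scalerA mulrC.
Qed.

Fact poset_act1 (a : deg n) (h : of_deg (a - a) 1) x : poset_act h x = x.
Proof. by rewrite /poset_act u_id /ev1 meval1 scale1r. Qed.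

Fact poset_actD (a b : deg n) p q (hp : of_deg (b - a) p) (hq : of_deg (b - a) q)
  (hpq : of_deg (b - a) (p + q)) x :
  poset_act hpq x = poset_act hp x + poset_act hq x.
Proof. by rewrite /poset_act /ev1 mevalD scalerDl. Qed.

Fact poset_actZ (a b : deg n) c p (hp : of_deg (b - a) p)
  (hcp : of_deg (b - a) (c *: p)) x : poset_act hcp x = c *: poset_act hp x.
Proof. by rewrite /poset_act /ev1 mevalZ scalerA. Qed.

Fact poset_actM (a b c : deg n) p q (hp : of_deg (c - b) p) (hq : of_deg (b - a) q)
  (hpq : of_deg (c - a) (p * q)) x :
  poset_act hpq x = poset_act hp (poset_act hq x).
Proof.
rewrite /poset_act linearZ scalerA {1}/ev1 mevalM -/(ev1 p) -/(ev1 q).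
(* Functoriality of [u] is assumed only along [a <= b <= c]; otherwise [p] or [q] is zero. *)
have [ab|ab] := boolP (dle a b); last by rewrite (ev1_nle hq ab) mulr0 !scale0r.
have [bc|bc] := boolP (dle b c); last by rewrite (ev1_nle hp bc) mul0r !scale0r.
by rewrite u_comp.
Qed.

Definition poset_gmod : gmod k n :=
  GMod poset_act_lin poset_act1 poset_actD poset_actZ poset_actM.

Lemma mact_poset a b x : dle a b -> mact poset_gmod a b x = u a b x.
Proof. by move=> ab; rewrite /mact /= /poset_act ev1_mon ?scale1r. Qed.

End PosetModule.

(** * Graded submodules and quotients *)

Section Submodule.
Variables (k : fieldType) (n : nat) (M : gmod k n) (S : forall a : deg n, M a -> Prop).
Arguments S : clear implicits.
Hypothesis hS : is_submod S.

(* The predicate mentions [hS] so that the closure instance can be inferred. *)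
Definition sub_pred (h : is_submod S) (a : deg n) : {pred M a} := [pred x | `[< S _ x >]].
Arguments sub_pred : clear implicits.

HB.instance Definition _ (h : is_submod S) a :=
  GRing.isSubmodClosed.Build k (M a) (sub_pred h a) (submod_closed_of h a).

Definition sub_car (a : deg n) := {x : M a | x \in sub_pred hS a}.

HB.instance Definition _ a := SubChoice.on (sub_car a).
HB.instance Definition _ a := [SubChoice_isSubLmodule of sub_car a by <:].

Fact sub_actP (a b : deg n) (y : sub_car a) : mact M a b (val y) \in sub_pred hS b.
Proof. have [_ _ Sa] := hS; by case: y => y /= /asboolP Sy; apply/asboolP/Sa. Qed.

Definition sub_act (a b : deg n) (y : sub_car a) : sub_car b := Sub (mact M a b (val y)) (sub_actP b y).

Fact sub_act_lin a b : linear (@sub_act a b).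
Proof. by move=> c x y; apply: val_inj; rewrite /= !linearP. Qed.

HB.instance Definition _ a b :=
  GRing.isLinear.Build k (sub_car a) (sub_car b) _ (@sub_act a b) (@sub_act_lin a b).

Fact sub_act_id a x : @sub_act a a x = x.
Proof. by apply: val_inj; exact: mact_id. Qed.

Fact sub_act_comp a b c x : dle a b -> dle b c ->
  @sub_act b c (@sub_act a b x) = @sub_act a c x.
Proof. by move=> ab bc; apply: val_inj; exact: mact_comp. Qed.

Definition sub_gmod : gmod k n := @poset_gmod k n sub_car (fun a b => @sub_act a b) sub_act_id sub_act_comp.

Definition sub_incl : nat_hom sub_gmod M.
Proof.
apply: (@nat_homB k n sub_gmod M (fun a y => val y)) => [a c x y|a b x ab].
  by rewrite linearP.
by rewrite mact_poset.
Defined.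

Lemma sub_incl_mono : mono sub_incl.
Proof. by move=> a; exact: val_inj. Qed.

Lemma sub_inclP a (x : M a) : S a x <-> exists y, sub_incl a y = x.
Proof.
split; last by case=> -[y /= /asboolP h] <-.
move=> /asboolP h; by exists (exist _ x h).
Qed.

End Submodule.

Section QuotientModule.
Variables (k : fieldType) (n : nat) (M : gmod k n) (S : forall a : deg n, M a -> Prop).
Arguments S : clear implicits.
Hypothesis hS : is_submod S.

Lemma submodN a x : S a (- x) -> S a x.
Proof. by move=> /(submodZ hS (-1)); rewrite scaleN1r opprK. Qed.

Section Piece.
Variable a : deg n.

Definition qrel (h : is_submod S) (x y : M a) : bool := `[< S _ (x - y) >].

Fact qrel_refl : reflexive (qrel hS).
Proof. by move=> x; apply/asboolP; rewrite subrr; have [] := hS. Qed.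
Fact qrel_sym : ssrbool.symmetric (qrel hS).
Proof.
by move=> x y; apply/asboolP/asboolP => h; apply: submodN; rewrite opprB.
Qed.
Fact qrel_trans : transitive (qrel hS).
Proof.
move=> y x z /asboolP xy /asboolP yz; apply/asboolP.
by rewrite -(subrK y x) -addrA; have [_ SD _] := hS; exact: SD.
Qed.

Canonical qrel_equiv := EquivRel (qrel hS) qrel_refl qrel_sym qrel_trans.
Definition quot_car := {eq_quot qrel_equiv}.
HB.instance Definition _ := Choice.on quot_car.

Definition qclass (x : M a) : quot_car := \pi_quot_car x.

Lemma qclassP x y : qclass x = qclass y <-> S _ (x - y).
Proof.
split; first by move=> /eqmodP /asboolP.
by move=> h; apply/eqmodP/asboolP.
Qed.

Lemma qclassW (P : quot_car -> Prop) : (forall x, P (qclass x)) -> forall x, P x.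
Proof. by move=> h x; rewrite -[x]reprK; exact: h. Qed.

Lemma repr_qclass x : S _ (repr (qclass x) - x).
Proof. by apply/qclassP; rewrite /qclass reprK. Qed.

Definition qadd (x y : quot_car) := qclass (repr x + repr y).
Definition qscale (c : k) (x : quot_car) := qclass (c *: repr x).

Lemma qadd_class x y : qadd (qclass x) (qclass y) = qclass (x + y).
Proof.
apply/qclassP; rewrite opprD addrACA.
by have [_ SD _] := hS; apply: SD; exact: repr_qclass.
Qed.

Lemma qscale_class c x : qscale c (qclass x) = qclass (c *: x).
Proof.
by apply/qclassP; rewrite -scalerBr; apply: (submodZ hS); exact: repr_qclass.
Qed.

Fact qaddA : associative qadd.
Proof.
by elim/qclassW=> x; elim/qclassW=> y; elim/qclassW=> z; rewrite !qadd_class addrA.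
Qed.
Fact qaddC : commutative qadd.
Proof. by elim/qclassW=> x; elim/qclassW=> y; rewrite !qadd_class addrC. Qed.
Fact qadd0 : left_id (qclass 0) qadd.
Proof. by elim/qclassW=> x; rewrite !qadd_class add0r. Qed.
Fact qaddN : left_inverse (qclass 0) (qscale (-1)) qadd.
Proof.
by elim/qclassW=> x; rewrite qscale_class qadd_class scaleN1r addNr.
Qed.

HB.instance Definition _ := GRing.isZmodule.Build quot_car qaddA qaddC qadd0 qaddN.

Fact qscaleA c e x : qscale c (qscale e x) = qscale (c * e) x.
Proof. by elim/qclassW: x => x; rewrite !qscale_class scalerA. Qed.
Fact qscale1 : left_id 1 qscale.
Proof. by elim/qclassW=> x; rewrite qscale_class scale1r. Qed.
Fact qscaleDr : right_distributive qscale +%R.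
Proof.
move=> c; elim/qclassW=> x; elim/qclassW=> y.
by rewrite /GRing.add /= qadd_class !qscale_class qadd_class scalerDr.
Qed.
Fact qscaleDl x : {morph qscale^~ x : c e / c + e}.
Proof.
elim/qclassW: x => x c e.
by rewrite [RHS]/GRing.add /= !qscale_class qadd_class scalerDl.
Qed.

HB.instance Definition _ :=
  GRing.Zmodule_isLmodule.Build k quot_car qscaleA qscale1 qscaleDr qscaleDl.

Fact qclass_lin : linear qclass.
Proof.
by move=> c x y; rewrite /GRing.scale /= [RHS]/GRing.add /= qscale_class qadd_class.
Qed.

HB.instance Definition _ := GRing.isLinear.Build k (M a) quot_car _ qclass qclass_lin.

End Piece.

Definition quot_act a b (x : quot_car a) : quot_car b := qclass (mact M a b (repr x)).

Lemma quot_act_class a b x : quot_act b (qclass x) = qclass (mact M a b x).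
Proof.
by apply/qclassP; rewrite -linearB; have [_ _ Sa] := hS; apply/Sa/repr_qclass.
Qed.

Fact quot_act_lin a b : linear (@quot_act a b).
Proof.
move=> c; elim/qclassW=> x; elim/qclassW=> y.
by rewrite -linearP !quot_act_class !linearP.
Qed.

HB.instance Definition _ a b :=
  GRing.isLinear.Build k (quot_car a) (quot_car b) _ (@quot_act a b) (@quot_act_lin a b).

Fact quot_act_id a x : @quot_act a a x = x.
Proof. by elim/qclassW: x => x; rewrite quot_act_class mact_id. Qed.

Fact quot_act_comp a b c x : dle a b -> dle b c ->
  @quot_act b c (@quot_act a b x) = @quot_act a c x.
Proof.
by elim/qclassW: x => x ab bc; rewrite !quot_act_class mact_comp.
Qed.

Definition quot_gmod : gmod k n :=
  @poset_gmod k n quot_car (fun a b => @quot_act a b) quot_act_id quot_act_comp.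

Definition quot_proj : nat_hom M quot_gmod.
Proof.
apply: (@nat_homB k n M quot_gmod (fun a x => qclass x)) => [a c x y|a b x ab].
  by rewrite linearP.
by rewrite mact_poset //= quot_act_class.
Defined.

Lemma quot_proj_epi : epi quot_proj.
Proof. by move=> a; elim/qclassW=> x; exists x. Qed.

Lemma quot_projP a (x : M a) : quot_proj a x = 0 <-> S a x.
Proof.
have -> : (quot_proj a x = 0) = (qclass x = qclass 0).
  by rewrite -[0]/(qclass 0).
by rewrite qclassP subr0.
Qed.

End QuotientModule.

(** * Factorization through epimorphisms and monomorphisms *)

Section Factorizations.
Variables (k : fieldType) (n : nat).
Implicit Types M N P : gmod k n.

Lemma im_is_submod M N (f : nat_hom M N) :
  is_submod (fun a (y : N a) => exists x, f a x = y).
Proof.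
apply: is_submodP => [a|a c _ _ [x <-] [y <-]|a b _ _ [x <-]].
- by exists 0; rewrite linear0.
- by exists (c *: x + y); rewrite linearP.
- by exists (mact M a b x); rewrite nfun_mact.
Qed.

Lemma ker_is_submod M N (f : nat_hom M N) : is_submod (fun a (x : M a) => f a x = 0).
Proof.
apply: is_submodP => [a|a c x y hx hy|a b x _ hx].
- by rewrite linear0.
- by rewrite linearP /= [f a x]hx [f a y]hy scaler0 addr0.
- by rewrite nfun_mact hx linear0.
Qed.

Lemma monoP M N (f : nat_hom M N) : mono f <-> forall a x, f a x = 0 -> x = 0.
Proof.
split=> [h a x e|h a x y e]; first by apply: h; rewrite e linear0.
by apply/eqP; rewrite -subr_eq0; apply/eqP/h; rewrite linearB /= e subrr.
Qed.

(** By the kernel condition [h] does not depend on the chosen preimages, which forces linearity and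
    compatibility with the action. *)
Lemma epi_factor M N P (g : nat_hom M N) (h : nat_hom M P) : epi g ->
  (forall a x, g a x = 0 -> h a x = 0) -> exists f, ncomp f g = h.
Proof.
move=> eg gh; pose s a y := sval (cid (eg a y)).
have sP a y : g a (s a y) = y by rewrite /s; case: cid.
have hs a x y : g a x = y -> h a (s a y) = h a x.
  move=> e; apply/eqP; rewrite -subr_eq0 -linearB; apply/eqP/gh.
  by rewrite linearB /= sP e subrr.
have fl a : linear (fun y => h a (s a y)).
  move=> c x y; rewrite -linearP; apply: hs.
  by rewrite linearP /= !sP.
have fa a b y : dle a b -> h b (s b (mact N a b y)) = mact P a b (h a (s a y)).
  by move=> ab; rewrite -nfun_mact; apply: hs; rewrite nfun_mact sP.
by exists (nat_homB fl fa); apply: nat_hom_ext => a x; exact: hs.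
Qed.

Lemma mono_factor M N P (i : nat_hom N M) (h : nat_hom P M) : mono i ->
  (forall a x, exists y, i a y = h a x) -> exists f, ncomp i f = h.
Proof.
move=> mi ih; pose s a x := sval (cid (ih a x)).
have sP a x : i a (s a x) = h a x by rewrite /s; case: cid.
have fl a : linear (s a) by move=> c x y; apply: mi; rewrite linearP /= !sP linearP.
have fa a b x : dle a b -> s b (mact P a b x) = mact N a b (s a x).
  by move=> ab; apply: mi; rewrite nfun_mact !sP nfun_mact.
by exists (nat_homB fl fa); apply: nat_hom_ext => a x; exact: sP.
Qed.

Lemma ncompA M N P Q (h : nat_hom P Q) (g : nat_hom N P) (f : nat_hom M N) :
  ncomp h (ncomp g f) = ncomp (ncomp h g) f.
Proof. exact: nat_hom_ext. Qed.

Lemma ncompf1 M N (f : nat_hom M N) : ncomp f (nid M) = f.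
Proof. exact: nat_hom_ext. Qed.

Lemma ncomp1f M N (f : nat_hom M N) : ncomp (nid N) f = f.
Proof. exact: nat_hom_ext. Qed.

Lemma ncompDl M N P (f g : nat_hom N P) (h : nat_hom M N) :
  ncomp (f + g) h = ncomp f h + ncomp g h.
Proof. exact: nat_hom_ext. Qed.

Lemma ncompDr M N P (f g : nat_hom M N) (h : nat_hom N P) :
  ncomp h (f + g) = ncomp h f + ncomp h g.
Proof. by apply: nat_hom_ext => a x; exact: linearD. Qed.

Lemma ncompNl M N P (f : nat_hom N P) (h : nat_hom M N) : ncomp (- f) h = - ncomp f h.
Proof. exact: nat_hom_ext. Qed.

Lemma ncompNr M N P (f : nat_hom M N) (h : nat_hom N P) : ncomp h (- f) = - ncomp h f.
Proof. by apply: nat_hom_ext => a x; exact: linearN. Qed.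

Lemma mono_epi_iso M N (f : nat_hom M N) : mono f -> epi f -> iso f.
Proof.
move=> mf ef; have [g fg] : exists g, ncomp f g = nid N.
  by apply: mono_factor => // a x; have [y <-] := ef a x; exists y.
exists g; split=> //; apply: nat_hom_ext => a x; apply: mf.
by rewrite -[LHS]/(ncomp f g a (f a x)) fg.
Qed.

(** Used to compare the image of a dual map with the dual of an image: both are quotients of one
    module by the same kernel. *)
Lemma epi_same_ker M N P (g : nat_hom M N) (h : nat_hom M P) : epi g -> epi h ->
  (forall a x, g a x = 0 <-> h a x = 0) -> exists2 f : nat_hom N P, iso f & ncomp f g = h.
Proof.
move=> eg eh gh; have [f fg] := epi_factor eg (fun a x => (gh a x).1).
have fE a x : f a (g a x) = h a x by rewrite -fg.
exists f => //; apply: mono_epi_iso => [|a z].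
  apply/monoP => a y; have [x <-] := eg a y.
  by rewrite fE => /gh.
by have [x <-] := eh a z; exists (g a x); rewrite fE.
Qed.

End Factorizations.

(** * Dickson's lemma and Baer's criterion *)

Section Dickson.
Variable n : nat.
Implicit Types a b c : deg n.

Lemma int_argmin (f : nat -> int) (a : int) N : (forall m, a <= f m) ->
  exists m, (N <= m)%N /\ forall m', (N <= m')%N -> f m <= f m'.
Proof.
move=> fa; pose P v := `[< exists2 m, (N <= m)%N & absz (f m - a) = v >].
have exP : exists v, P v by exists (absz (f N - a)); apply/asboolP; exists N.
have [_ /asboolP[m Nm <-] hm] := ex_minnP exP.
exists m; split=> // m' Nm'; rewrite -(lerD2r (- a)).
rewrite -[f m - a]gez0_abs ?subr_ge0 // -[f m' - a]gez0_abs ?subr_ge0 // lez_nat.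
by apply: hm; apply/asboolP; exists m'.
Qed.

Lemma int_mono_subseq (f : nat -> int) (a : int) : (forall m, a <= f m) ->
  exists g : nat -> nat, (forall i j, (i < j)%N -> (g i < g j)%N) /\
    forall i j, (i <= j)%N -> f (g i) <= f (g j).
Proof.
move=> fa; have [s sP] := choice (fun N => int_argmin N fa).
(* [s N] is an index where [f] is least from [N] on; restarting just after each choice makes the
   chosen values nondecreasing. *)
pose g := fix g i := if i is i'.+1 then s (g i').+1 else s 0%N.
have gS i : (g i < g i.+1)%N by have [] := sP (g i).+1.
have g_lt i j : (i < j)%N -> (g i < g j)%N by apply: (@homo_ltn _ _ _ ltn_trans).
have g_le i j : (i <= j)%N -> (g i <= g j)%N.
  by rewrite leq_eqVlt => /orP[/eqP->//|/g_lt/ltnW].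
exists g; split=> // i j ij; case: i ij => [|i] ij.
  by have [_ h] := sP 0%N; exact: h.
by have [_ h] := sP (g i).+1; apply: h; apply: leq_trans (g_le _ _ ij).
Qed.

(** Subsequences are extracted one coordinate at a time, until all coordinates are monotone. *)
Lemma dickson (u : nat -> deg n) a : (forall m, dle a (u m)) ->
  exists i j, (i < j)%N /\ dle (u i) (u j).
Proof.
move=> ua; have sub (l : seq 'I_n) : exists g : nat -> nat,
    (forall i j, (i < j)%N -> (g i < g j)%N) /\
    forall i j, (i <= j)%N -> {in l, forall x, u (g i) x <= u (g j) x}.
  elim: l => [|x l [g [g1 g2]]]; first by exists id.
  have ux m : a x <= u (g m) x by exact: (dleP _ _ (ua _)).
  have [h [h1 h2]] := int_mono_subseq ux.
  exists (g \o h); split=> [i j ij|i j ij y] /=; first exact/g1/h1.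
  rewrite inE => /orP[/eqP->|yl]; first exact: h2.
  apply: g2 => //; move: ij; rewrite leq_eqVlt => /orP[/eqP->//|/h1/ltnW//].
have [g [g1 g2]] := sub (enum 'I_n).
exists (g 0%N), (g 1%N); split; first exact: g1.
by apply/dleP => i; apply: g2; rewrite ?mem_enum.
Qed.

(** Without a finite basis one could keep choosing elements that lie above no earlier one, against
    [dickson]. *)
Lemma dickson_basis (U : deg n -> Prop) a : exists s : seq (deg n),
  (forall v, v \in s -> U v /\ dle a v) /\
  forall u, U u -> dle a u -> exists2 v, v \in s & dle v u.
Proof.
apply: contrapT => no.
pose ok (s : seq (deg n)) := forall v, v \in s -> U v /\ dle a v.
(* The condition [ok s] sits under the existential so that the choice function [st] is defined on
   all lists. *)
have ex s : exists u, ok s -> [/\ U u, dle a u & forall v, v \in s -> ~~ dle v u].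
  apply: contrapT => h; apply: no; exists s.
  have oks : ok s by apply: contrapT => h'; apply: h; exists a.
  split=> // u Uu au; apply: contrapT => h'; apply: h; exists u => _; split=> // v vs.
  by apply/negP => vu; apply: h'; exists v.
have [st stP] := choice ex.
pose t := fix t m := if m is m'.+1 then st (t m') :: t m' else [::].
have okt m : ok (t m).
  elim: m => [|m IH] v //=; rewrite inE => /orP[/eqP->|/IH//].
  by have [] := stP _ IH.
have mt i j : (i < j)%N -> st (t i) \in t j.
  elim: j => // j IH; rewrite ltnS leq_eqVlt => /orP[/eqP->|/IH h].
    exact: mem_head.
  by rewrite inE h orbT.
have [m|i [j [ij h]]] := @dickson (fun m => st (t m)) a.
  by have [] := stP _ (okt m).
by have [_ _ /(_ _ (mt _ _ ij)) /negP] := stP _ (okt j).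
Qed.

(** Ascending chains of up-sets above [a] stop: degrees witnessing strict growth would never lie
    above an earlier one. With [I] an annihilator, this is the existence of maximal annihilators. *)
Lemma dickson_max (T : Type) (x0 : T) (I : T -> deg n -> Prop) a :
  (forall x c c', I x c -> dle c c' -> I x c') ->
  exists x, forall y, (forall c, dle a c -> I x c -> I y c) ->
    forall c, dle a c -> I y c -> I x c.
Proof.
move=> Iup; apply: contrapT => no.
have ex x : exists yc : T * deg n, (forall c, dle a c -> I x c -> I yc.1 c) /\
    [/\ dle a yc.2, I yc.1 yc.2 & ~ I x yc.2].
  apply: contrapT => h; apply: no; exists x => y xy c ac yc.
  by apply: contrapT => nx; apply: h; exists (y, c).
have [f fP] := choice ex.
pose t m := iter m (fun x => (f x).1) x0.
have tI i j c : (i <= j)%N -> dle a c -> I (t i) c -> I (t j) c.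
  move=> ij ac; elim: j ij => [|j IH]; first by rewrite leqn0 => /eqP->.
  rewrite leq_eqVlt => /orP[/eqP->//|/IH h /h]; exact: (fP _).1.
have [m|i [j [ij h]]] := @dickson (fun m => (f (t m)).2) a.
  by have [_ []] := fP (t m).
have [_ [_ _ nj]] := fP (t j); apply: nj; apply: Iup h.
by have [_ [ac ic _]] := fP (t i); apply: (tI i.+1).
Qed.

End Dickson.

(** * Sufficiency of Baer's condition, by Zorn's lemma *)

Section Injectivity.
Variables (k : fieldType) (n : nat).
Implicit Types A B E : gmod k n.

(** Injectivity for degree-preserving morphisms into [E] itself, whereas [injective_gmod] involves
    all shifts of [E]; [injectiveP] identifies the two. *)
Definition lifts E := forall A B (f : nat_hom A B) (g : nat_hom A E), mono f ->
  exists h, ncomp h f = g.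

(** Baer's criterion: [e] is a map to [E] from the ideal generated by the
    [x^(b j - a)], shifted to start in degree [a]. *)
Definition baer E := forall (a : deg n) (I : finType) (b : I -> deg n)
    (e : forall j, E (b j)), (forall j, dle a (b j)) ->
  (forall i j, mact E (b i) (dmax (b i) (b j)) (e i) = mact E (b j) (dmax (b i) (b j)) (e j)) ->
  exists x : E a, forall j, mact E a (b j) x = e j.

Section Extension.
Variables (A B E : gmod k n) (f : nat_hom A B) (g : nat_hom A E).
Hypotheses (mf : mono f) (bE : baer E).

(* Partial extensions of [g] along [f], given by their graphs. *)
Let rel := forall a : deg n, B a -> E a -> Prop.

Record pext (G : rel) : Prop := Pext {
  pext_lin : forall a (c : k) x x' y y', G a x y -> G a x' y' -> G a (c *: x + x') (c *: y + y');
  pext_act : forall a b x y, dle a b -> G a x y -> G b (mact B a b x) (mact E a b y);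
  pext_fun : forall a y, G a 0 y -> y = 0;
  pext_graph : forall a x, G a (f a x) (g a x) }.

Lemma pext0 G a : pext G -> G a 0 0.
Proof. by case=> _ _ _ /(_ a 0); rewrite !linear0. Qed.

Lemma pext_uniq G a x y y' : pext G -> G a x y -> G a x y' -> y = y'.
Proof.
move=> hG h h'; apply/eqP; rewrite -subr_eq0; apply/eqP; apply: (pext_fun hG).
have := pext_lin hG (-1) h' h.
by rewrite !scaleN1r addNr [- y' + _]addrC.
Qed.

Definition base : rel := fun a x y => exists2 z, x = f a z & y = g a z.

Lemma pext_base : pext base.
Proof.
split.
- move=> a c _ _ _ _ [z -> ->] [z' -> ->]; exists (c *: z + z'); by rewrite linearP.
- by move=> a b _ _ _ [z -> ->]; exists (mact A a b z); rewrite nfun_mact.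
- by move=> a y [z e ->]; rewrite (mf (esym (etrans (linear0 _) e))) linear0.
- by move=> a x; exists x.
Qed.

(** The monomials taking [x0] into the domain of [G] generate an ideal, finitely generated by
    [dickson_basis]. Baer's condition gives a value [y0] for [x0] consistent with [G] on it, so [G]
    extends by [x0 |-> y0], and maximality puts [x0] in the domain. *)
Lemma pext_total G : pext G -> (forall G', pext G' ->
    (forall a x y, G a x y -> G' a x y) -> forall a x y, G' a x y -> G a x y) ->
  forall a x, exists y, G a x y.
Proof.
move=> hG maxG a0 x0; pose U b := exists y, G b (mact B a0 b x0) y.
have [s [sU sb]] := dickson_basis U a0.
have ex (j : 'I_(size s)) : exists y, G (tnth (in_tuple s) j) (mact B a0 _ x0) y.
  by have [] := sU _ (mem_tnth j (in_tuple s)).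
pose e j := sval (cid (ex j)).
have eP j : G _ (mact B a0 _ x0) (e j) by rewrite /e; case: cid.
have aj (j : 'I_(size s)) : dle a0 (tnth (in_tuple s) j).
  by have [] := sU _ (mem_tnth j (in_tuple s)).
have [|y0 y0P] := bE (e := e) aj.
  move=> i j; apply: (pext_uniq hG (x := mact B a0 _ x0)).
    by rewrite -(mact_comp _ (aj i) (dle_maxl _ _)); exact: (pext_act hG (dle_maxl _ _) (eP i)).
  by rewrite -(mact_comp _ (aj j) (dle_maxr _ _)); exact: (pext_act hG (dle_maxr _ _) (eP j)).
have GU b : U b -> dle a0 b -> G b (mact B a0 b x0) (mact E a0 b y0).
  move=> Ub ab; have [v vs vb] := sb _ Ub ab.
  have [j ev] : exists j, v = tnth (in_tuple s) j by apply/tnthP.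
  rewrite ev in vb; rewrite -!(mact_comp _ (aj j) vb) y0P.
  exact: (pext_act hG).
pose G' : rel := fun b x y => exists c x1 y1, [/\ G b x1 y1,
  x = c *: mact B a0 b x0 + x1 & y = c *: mact E a0 b y0 + y1].
have GG' b x y : G b x y -> G' b x y.
  by move=> h; exists 0, x, y; split=> //; rewrite scale0r add0r.
exists y0; apply: (maxG G') => //; last first.
  by exists 1, 0, 0; rewrite !mact_id !scale1r !addr0; split=> //; exact: pext0 hG.
split.
- move=> b c _ _ _ _ [c1 [x1 [y1 [h1 -> ->]]]] [c2 [x2 [y2 [h2 -> ->]]]].
  exists (c * c1 + c2), (c *: x1 + x2), (c *: y1 + y2); split; first exact: pext_lin.
    by rewrite !scalerDr !scalerA scalerDl addrACA.
  by rewrite !scalerDr !scalerA scalerDl addrACA.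
- move=> b b' _ _ bb' [c1 [x1 [y1 [h1 -> ->]]]].
  have h2 := pext_act hG bb' h1.
  have [ab|ab] := boolP (dle a0 b).
    by exists c1, (mact B b b' x1), (mact E b b' y1); rewrite !linearP /= !mact_comp.
  exists 0, (mact B b b' x1), (mact E b b' y1).
  by rewrite !(mact_nle _ ab) !scaler0 !scale0r !add0r.
- move=> b y [c [x1 [y1 [h1 e1 ->]]]].
  have [ab|ab] := boolP (dle a0 b); last first.
    rewrite (mact_nle _ ab) scaler0 add0r in e1; rewrite (mact_nle _ ab) scaler0 add0r.
    by apply: (pext_fun hG); rewrite e1.
  have [c0|c0] := eqVneq c 0.
    rewrite c0 scale0r add0r in e1; rewrite c0 scale0r add0r.
    by apply: (pext_fun hG); rewrite e1.
  (* A relation with [c] nonzero puts the multiple of [x0] of degree [b] in the domain, where [GU]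
     gives its value. *)
  have e2 : mact B a0 b x0 = (- c^-1) *: x1 + 0.
    apply: (scalerI c0); apply/eqP; rewrite addr0 scalerA mulrN divff // scaleN1r.
    by rewrite -addr_eq0 -e1.
  have Ub : U b.
    exists ((- c^-1) *: y1 + 0); rewrite e2; apply: (pext_lin hG) => //; exact: pext0 hG.
  apply: (pext_fun hG); rewrite e1; apply: (pext_lin hG) => //; exact: GU.
- by move=> b x; apply/GG'/(pext_graph hG).
Qed.

Lemma baer_extend : exists h, ncomp h f = g.
Proof.
pose T := {G : rel | pext G}.
pose R (s t : T) := `[< forall a x y, sval s a x y -> sval t a x y >].
have t0 : T by exists base; exact: pext_base.
(* Zorn's lemma: a nonempty chain is bounded by its union, the empty chain by [t0]. *)
have [||C tC|[G hG] maxG] := @classical_sets.ZL_preorder T t0 R.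
- by move=> t; apply/asboolP.
- move=> r s t /asboolP h /asboolP h'; apply/asboolP => a x y /h; exact: h'.
- have [[s0 s0C]|nC] := pselect (exists s, C s); last first.
    by exists t0 => s sC; case: nC; exists s.
  pose G : rel := fun a x y => exists2 s : T, C s & sval s a x y.
  have join s t : C s -> C t -> exists2 r, C r &
      (forall a x y, sval s a x y -> sval r a x y) /\
      (forall a x y, sval t a x y -> sval r a x y).
    move=> sC uC; have [/asboolP h|/asboolP h] := tC _ _ sC uC.
      by exists t.
    by exists s.
  have hG : pext G.
    split.
    - move=> a c x x' y y' [s sC h] [t uC h']; have [r rC [sr tr]] := join _ _ sC uC.
      exists r => //; apply: (pext_lin (svalP r)); [exact: sr|exact: tr].
    - by move=> a b x y ab [s sC h]; exists s => //; exact: (pext_act (svalP s)).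
    - by move=> a y [s sC h]; exact: (pext_fun (svalP s)) h.
    - by move=> a x; exists s0 => //; exact: (pext_graph (svalP s0)).
  by exists (exist _ G hG) => s sC; apply/asboolP => a x y h; exists s.
have tot : forall a x, exists y, G a x y.
  apply: (pext_total hG) => G' hG' GG' a x y h.
  have /asboolP h' := maxG (exist _ G' hG') (introT (asboolP _) GG').
  exact: h'.
pose h a x := sval (cid (tot a x)).
have hP a x : G a x (h a x) by rewrite /h; case: cid.
have hl a : linear (h a).
  by move=> c x y; apply: (pext_uniq hG (hP _ _)); exact: (pext_lin hG).
have ha a b x : dle a b -> h b (mact B a b x) = mact E a b (h a x).
  by move=> ab; apply: (pext_uniq hG (hP _ _)); exact: (pext_act hG).
exists (nat_homB hl ha); apply: nat_hom_ext => a x.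
by apply: (pext_uniq hG (hP _ _)); exact: (pext_graph hG).
Qed.

End Extension.

Lemma baer_lifts E : baer E -> lifts E.
Proof. by move=> bE A B f g mf; exact: baer_extend. Qed.

End Injectivity.

Section Constant.
Variables (k : fieldType) (n : nat) (V : lmodType k).

(** For [V = k] this is the Laurent polynomial ring, which contains the ideals of Baer's criterion;
    general [V] turn linear maps into graded morphisms. *)
Definition const_gmod : gmod k n :=
  @poset_gmod k n (fun _ => V) (fun _ _ => idfun) (fun _ _ => erefl)
    (fun _ _ _ _ _ _ => erefl).

Lemma mact_const (a b : deg n) (x : V) : dle a b -> mact const_gmod a b x = x.
Proof. by move=> ab; rewrite mact_poset. Qed.

End Constant.
Arguments const_gmod k n V : clear implicits.

(** * Injectivity, lifting and Baer's condition *)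

Section InjectivityCriteria.
Variables (k : fieldType) (n : nat).
Implicit Types A B E : gmod k n.

(** The kernel condition makes [g] descend to the image of [f], from which it extends. *)
Lemma lifts_ker E A B (f : nat_hom A B) (g : nat_hom A E) : lifts E ->
  (forall a x, f a x = 0 -> g a x = 0) -> exists h, ncomp h f = g.
Proof.
move=> lE fg; have pe : epi (im_proj f).
  by move=> a [y /= yf]; have /asboolP[x e] := yf; exists x; apply: val_inj.
have [||g' gE] := @epi_factor k n _ _ _ (im_proj f) g => //.
  by move=> a x e; apply: fg; rewrite -[f a x]/(val (im_proj f a x)) e.
have [|h hE] := lE _ _ (im_incl f) g'; first by move=> a; exact: val_inj.
by exists h; rewrite -gE -hE; exact: nat_hom_ext.
Qed.

Lemma lifts_iso E E' (f : nat_hom E E') : iso f -> lifts E -> lifts E'.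
Proof.
move=> [f' [_ ff']] lE A B i g mi; have [h hE] := lE _ _ i (ncomp f' g) mi.
by exists (ncomp f h); rewrite -ncompA hE ncompA ff' ncomp1f.
Qed.

Definition unshift0 E : nat_hom (shift 0 E) E.
Proof.
apply: (@nat_homB k n (shift 0 E) E (fun a x => mact E (0 + a) a x)) => [a c x y|a b x ab].
  exact: linearP.
by rewrite mact_shift !mact_comp ?add0r.
Defined.

Lemma unshift0_iso E : iso (unshift0 E).
Proof.
apply: mono_epi_iso => [|a y].
  apply/monoP => a x e; rewrite -[LHS](mact_castK (M := E) (add0r a)).
  by rewrite -[mact E _ _ x]/(unshift0 E a x) e linear0.
by exists (mact E a (0 + a) y); rewrite /= mact_castK ?add0r.
Qed.

Lemma injective_lifts_shift E s : injective_gmod E -> lifts (shift s E).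
Proof.
move=> iE A B f g mf; pose p := quot_proj (im_is_submod f).
have se : short_exact f p.
  by split=> // [a y|]; [exact: quot_projP|exact: quot_proj_epi].
have [_ _ e] := iE _ _ _ _ _ se.
by have [h hE] := e s g; exists h.
Qed.

Lemma injective_lifts E : injective_gmod E -> lifts E.
Proof.
by move=> iE; exact: lifts_iso (unshift0_iso E) (injective_lifts_shift iE).
Qed.

Lemma lifts_shift_injective E : (forall s, lifts (shift s E)) -> injective_gmod E.
Proof.
move=> lE A B C f g [mf fg eg]; split.
- move=> s h h' e; apply: nat_hom_ext => a y; have [x <-] := eg a y.
  by rewrite -[LHS]/(ncomp (h : nat_hom _ _) g a x) [ncomp _ _]e.
- move=> s h; split=> [e|[h' <-]]; last first.
    apply: nat_hom_ext => a x; rewrite /=.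
    by rewrite (fg a _).2 ?linear0 //; exists x.
  have [|h' hE] := @epi_factor k n _ _ _ g (h : nat_hom _ _) eg; last by exists h'.
  move=> a y /fg[x <-].
  by rewrite -[LHS]/(ncomp (h : nat_hom _ _) f a x) [ncomp _ _]e.
- by move=> s h; have [h' hE] := lE s _ _ f h mf; exists h'.
Qed.

(** The [e j] define a morphism on the submodule [S] of the Laurent ring generated in the degrees
    [b j]. Extended to the whole ring, it takes 1 in degree [a] to the required element. *)
Lemma lifts_baer E : lifts E -> baer E.
Proof.
move=> lE a I b e ab eP.
have eP' c i j : dle (b i) c -> dle (b j) c -> mact E (b i) c (e i) = mact E (b j) c (e j).
  move=> ic jc; have mc := dmax_lub ic jc.
  by rewrite -(mact_comp _ (dle_maxl _ _) mc) eP mact_comp // dle_maxr.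
(* The image of 1 in degree [c]; the default 0 applies where [S] is zero. *)
pose m c : E c := if [pick j | dle (b j) c] is Some j then mact E (b j) c (e j) else 0.
have mE c j : dle (b j) c -> m c = mact E (b j) c (e j).
  by rewrite /m; case: pickP => [i ic jc|no]; [exact: eP'|rewrite no].
pose S c (x : const_gmod k n k^o c) := (exists j, dle (b j) c) \/ x = 0.
have hS : is_submod S.
  apply: is_submodP => [c|c r x y [h _|->]|c d x cd].
  - by right.
  - by left.
  - by case=> [h|->]; [left|right; rewrite scaler0 addr0].
  - by case=> [[j h]|->]; [left; exists j; exact: dle_trans cd|right; rewrite linear0].
have gl c : linear (fun x : sub_gmod hS c => (val x : k) *: m c).
  by move=> r x y; rewrite linearP scalerDl scalerA.
have ga c d (x : sub_gmod hS c) : dle c d ->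
    (val (mact (sub_gmod hS) c d x) : k) *: m d = mact E c d ((val x : k) *: m c).
  move=> cd; have -> : val (mact (sub_gmod hS) c d x) = val x.
    by rewrite -[LHS]/(sub_incl hS d _) nfun_mact mact_const.
  rewrite linearZ /=.
  case: x => x /= /asboolP[[j jc]|->]; last by rewrite !scale0r.
  by rewrite (mE _ _ jc) mact_comp // (mE d j) // (dle_trans jc).
have [h hE] := lE _ _ (sub_incl hS) (nat_homB gl ga) (@sub_incl_mono _ _ _ _ hS).
exists (h a (1 : k^o)) => j.
rewrite -nfun_mact mact_const //.
have [y yE] : exists y, sub_incl hS (b j) y = (1 : k^o).
  by apply/sub_inclP; left; exists j.
rewrite -yE -[LHS]/(ncomp h (sub_incl hS) _ y) hE /=.
by rewrite [val y]yE scale1r (mE _ j) // mact_id.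
Qed.

(** Baer's condition treats all degrees alike; its shift invariance is what leads from [lifts] back
    to [injective_gmod]. *)
Lemma baer_shift s E : baer E -> baer (shift s E).
Proof.
move=> bE a I b e ab eP.
have [||x xP] := bE (s + a) I (fun j => s + b j) e.
- by move=> j; rewrite dle_add2l.
- move=> i j; have -> : dmax (s + b i) (s + b j) = s + dmax (b i) (b j).
    by apply/ffunP => x; rewrite !ffunE addr_maxr.
  by have := eP i j; rewrite !mact_shift.
- by exists x => j; rewrite mact_shift; exact: xP.
Qed.

Lemma injective_baer E : injective_gmod E <-> baer E.
Proof.
split=> [/injective_lifts/lifts_baer //|bE].
by apply: lifts_shift_injective => s; apply/baer_lifts/baer_shift.
Qed.

Lemma injectiveP E : injective_gmod E <-> lifts E.
Proof.
by split=> [/injective_lifts //|/lifts_baer/injective_baer].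
Qed.

(** Essentiality is applied to the cyclic submodule generated by [e], made of scalar multiples of
    monomials times [e]; the scalar is absorbed into [m]. *)
Lemma hull_meets M E (i : nat_hom M E) : injective_hull i -> forall a (e : E a),
  e != 0 -> exists c m, [/\ dle a c, mact E a c e = i c m & i c m != 0].
Proof.
case=> _ _ ess a e e0; pose S b (y : E b) := exists c : k, y = c *: mact E a b e.
have hS : is_submod S.
  apply: is_submodP => [b|b c _ _ [r ->] [r' ->]|b b' _ bb' [r ->]].
  - by exists 0; rewrite scale0r.
  - by exists (c * r + r'); rewrite scalerDl scalerA.
  - have [ab|ab] := boolP (dle a b); first by exists r; rewrite linearZ /= mact_comp.
    by exists 0; rewrite (mact_nle _ ab) scaler0 linear0 scale0r.
have [|b [m [[c E1] n0]]] := ess S hS.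
  by exists a, e; split=> //; exists 1; rewrite mact_id scale1r.
have c0 : c != 0 by apply: contraNneq n0 => c0; rewrite E1 c0 scale0r.
have ab : dle a b by apply: contraNT n0 => /mact_nle h; rewrite E1 h scaler0.
exists b, (c^-1 *: m); rewrite linearZ /= E1 scalerA mulVf // scale1r; split=> //.
by apply: contraNneq n0 => e1; rewrite E1 e1 scaler0.
Qed.

End InjectivityCriteria.

(** * Duality *)

Definition mklinear (k : fieldType) (V W : lmodType k) (f : V -> W) (h : linear f) :
  {linear V -> W} := HB.pack f (GRing.isLinear.Build k V W _ f h).

(** * Elements of the Matlis dual as functionals *)

Section Pairing.
Variables (k : fieldType) (n : nat) (Ek : gmod k n) (iota : nat_hom (residue k n) Ek).
Hypothesis hEk : injective_hull iota.
Implicit Types (a b s t : deg n) (M N : gmod k n).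

(** The row has one entry if [a = 0] and none otherwise, so the sum reads off the entry without a
    cast. *)
Definition rsum a (v : residue k n a) : k := \sum_j (v : 'rV_(a == 0)) 0 j.

Lemma rsum_eq0 a (v : residue k n a) : rsum v = 0 -> v = 0.
Proof.
move: v; rewrite /rsum /= /res_car; case: (a == 0) => v e; last exact: thinmx0.
apply/rowP => j; move: e; rewrite big_ord_recl big_ord0 addr0 mxE => <-.
by congr (v _ _); exact: ord1.
Qed.

Lemma residue_eq0 a (v : residue k n a) : a != 0 -> v = 0.
Proof. by move: v; rewrite /= /res_car => v /negPf e; move: v; rewrite e => v; exact: thinmx0. Qed.

Definition rone a : residue k n a := const_mx 1.

Lemma rsum_rone a : a = 0 -> rsum (rone a) = 1.
Proof.
move=> ->; rewrite /rsum; under eq_bigr do rewrite mxE.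
by rewrite sumr_const card_ord eqxx.
Qed.

(** A nonzero [e] has a nonzero multiple in the image of the residue field, which lives in degree 0
    only, so this multiple is [e] itself. *)
Lemma hull_top (e : Ek 0) : exists m, iota 0 m = e.
Proof.
have [->|e0] := eqVneq e 0; first by exists 0; rewrite linear0.
have [c [m [_ E1 n0]]] := hull_meets hEk e0.
have c0 : c = 0.
  by apply/eqP; apply: contraNT n0 => /(residue_eq0 m) ->; rewrite linear0.
by subst c; exists m; rewrite -E1 mact_id.
Qed.

(** The isomorphism of [Ek 0] with [k] inverse to [iota]. *)
Definition socle (e : Ek 0) : k := rsum (sval (cid (hull_top e))).

Lemma socle_iota (m : residue k n 0) : socle (iota 0 m) = rsum m.
Proof.
rewrite /socle; case: cid => m' /= e; congr rsum.
by have [mi _ _] := hEk; exact: mi e.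
Qed.

Fact socle_lin : linear (socle : Ek 0 -> k^o).
Proof.
move=> c x y; have [m <-] := hull_top x; have [m' <-] := hull_top y.
rewrite -linearP !socle_iota /rsum scaler_sumr -big_split /=.
by apply: eq_bigr => j _; rewrite !mxE.
Qed.

HB.instance Definition _ := GRing.isLinear.Build k (Ek 0) k^o _ socle socle_lin.

Lemma socle_eq0 e : socle e = 0 -> e = 0.
Proof.
have [m <-] := hull_top e; rewrite socle_iota => /rsum_eq0 ->; exact: linear0.
Qed.

(** The pairing between [M_a] and [(matlis Ek M)_b]; it is perfect when [b + a = 0]. *)
Definition pr M b a (f : matlis Ek M b) (x : M a) : k^o :=
  socle (mact Ek (b + a) 0 ((f : nat_hom _ _) a x)).

Fact pr_linr M b a (f : matlis Ek M b) : linear (fun x : M a => pr f x).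
Proof.
by move=> c x y; rewrite /pr !linearP.
Qed.

HB.instance Definition _ M b a (f : matlis Ek M b) :=
  GRing.isLinear.Build k (M a) k^o _ (@pr M b a f) (pr_linr f).

Lemma pr_linl M b a (x : M a) (c : k) (f g : matlis Ek M b) :
  pr (c *: f + g) x = c *: pr f x + pr g x.
Proof.
rewrite /pr -[((c *: f + g) : nat_hom _ _) a x]/(c *: (f : nat_hom _ _) a x + (g : nat_hom _ _) a x : Ek (b + a)).
by rewrite !linearP.
Qed.

Definition prl M b a (x : M a) (f : matlis Ek M b) : k^o := pr f x.

HB.instance Definition _ M b a (x : M a) :=
  GRing.isLinear.Build k (matlis Ek M b) k^o _ (@prl M b a x) (pr_linl x).

Lemma pr_mactr M b a a' (f : matlis Ek M b) (x : M a) : dle a a' -> dle (b + a') 0 ->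
  pr f (mact M a a' x) = pr f x.
Proof.
move=> aa' ba'; rewrite /pr nfun_mact mact_shift mact_comp //.
by rewrite dle_add2l.
Qed.

Lemma pr_mactl M b b' a (f : matlis Ek M b) (x : M a) : dle b b' -> dle (b' + a) 0 ->
  pr (mact (matlis Ek M) b b' f) x = pr f x.
Proof.
move=> bb' ba; rewrite /pr mact_ghom mact_comp //.
by rewrite dle_add2r.
Qed.

Lemma pr_nat M N b a (f : matlis Ek N b) (g : nat_hom M N) (x : M a) :
  pr (matlis_map Ek g b f) x = pr f (g a x).
Proof. by []. Qed.

(** A nonzero value of [f] has a nonzero multiple in the image of [iota], hence in degree 0 of [Ek].
    It is the value of [f] at a multiple of [x] in degree [s], where [pr] detects it. *)
Lemma pr_eq0 M t s b (f : matlis Ek M t) (x : M b) : t + s = 0 ->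
  (dle b s -> pr f (mact M b s x) = 0) -> (f : nat_hom _ _) b x = 0.
Proof.
move=> ts h; apply/eqP; apply: contraT => n0.
have [c [m [tc E1 n1]]] := hull_meets hEk n0.
have c0 : c = 0.
  by apply/eqP; apply: contraNT n1 => /(residue_eq0 m) ->; rewrite linear0.
subst c; have bs : dle b s by rewrite -(dle_add2l t) ts.
have := h bs; rewrite pr_mactr ?ts // => /socle_eq0 e.
by rewrite -E1 e eqxx in n1.
Qed.

Lemma dual_ext M t s (f g : matlis Ek M t) : t + s = 0 ->
  (forall x : M s, pr f x = pr g x) -> f = g.
Proof.
move=> ts fg; apply/eqP; rewrite -subr_eq0; apply/eqP; apply: nat_hom_ext => b x.
apply: (pr_eq0 ts) => bs; rewrite -[f - g]addrC -scaleN1r pr_linl fg.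
by rewrite scaleN1r addNr.
Qed.

(* [phi] gives a map from the truncation of [M] to degrees [>= s], through its
   quotient in degree [s], to the shifted residue field; extend it to [M]. *)
Lemma dual_exists M t s (phi : {linear M s -> k^o}) : t + s = 0 ->
  exists f : matlis Ek M t, forall x, pr f x = phi x.
Proof.
move=> ts; pose S b (x : M b) := dle s b \/ x = 0.
have hS : is_submod S.
  apply: is_submodP => [b|b c x y|b b' x bb'].
  - by right.
  - by case=> [h|->] //; [left|rewrite scaler0 add0r].
  - by case=> [h|->]; [left; exact: dle_trans bb'|right; rewrite linear0].
(* Only degree [s] contributes, since the residue field vanishes in degree [t + b] for [b <> s]. *)
pose g b (y : sub_gmod hS b) : shift t Ek b := phi (mact M b s (val y)) *: iota (t + b) (rone _).
have gl b : linear (g b).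
  by move=> c x y; rewrite /g !linearP scalerDl scalerA.
have ga b b' y : dle b b' -> g b' (mact (sub_gmod hS) b b' y) = mact (shift t Ek) b b' (g b y).
  move=> bb'; rewrite /g -[val (mact _ _ _ y)]/(sub_incl hS b' _) nfun_mact.
  rewrite mact_shift mactZ -(nfun_mact iota) -[sub_incl hS b y]/(val y).
  have := valP y; move: (val y) => z /asboolP[sb|->]; last by rewrite !linear0 !scale0r.
  have [e|b's] := eqVneq b' s.
    have e' : b = b' by apply: dle_anti => //; rewrite e.
    by subst b' b; rewrite !mact_id.
  rewrite [X in phi X]mact_nle ?linear0 ?scale0r; last first.
    apply: contraNN b's => h; rewrite (dle_anti h) //; exact: dle_trans bb'.
  rewrite [mact _ _ _ (rone _)]residue_eq0 ?linear0 ?scaler0 //.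
  by apply: contraNneq b's => h; apply/eqP/(addrI t); rewrite h.
have iE : injective_gmod Ek by case: hEk.
have [f fE] := injective_lifts_shift iE (nat_homB gl ga) (@sub_incl_mono _ _ _ _ hS).
exists f => x; rewrite /pr.
have [y yE] : exists y, sub_incl hS s y = x by apply/sub_inclP; left.
rewrite -yE -[f s _]/(ncomp f (sub_incl hS) s y) fE -[nat_homB gl ga s y]/(g s y) /g [val y]yE mact_id.
have sZ (c : k) e : socle (c *: e) = c * socle e by rewrite linearZ.
rewrite mactZ sZ -(nfun_mact iota) socle_iota -[RHS]mulr1; congr (_ * _); first by rewrite yE.
(* The degree [t + s] is abstracted as [c] so that its equality with 0 can be substituted. *)
have h c : c = 0 -> rsum (mact (residue k n) c 0 (rone c)) = 1.
  by move=> ->; rewrite mact_id rsum_rone.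
exact: h.
Qed.

(* A functional on [V] is a morphism to [Ek] from the constant module [V], so
   functionals extend because [Ek] is injective. *)
Lemma functional_factor (V W : lmodType k) (f : {linear V -> W}) (g : {linear V -> k^o}) :
  (forall v, f v = 0 -> g v = 0) -> exists h : {linear W -> k^o}, forall v, h (f v) = g v.
Proof.
move=> fg; pose A := const_gmod k n V; pose B := const_gmod k n W.
have Fl (a : deg n) : linear (f : A a -> B a) by exact: linearP.
have Fa a b x : dle a b -> f (mact A a b x) = mact B a b (f x).
  by move=> ab; rewrite !mact_const.
pose F := nat_homB Fl Fa; have z0 : (0 : deg n) + 0 = 0 by rewrite addr0.
have [G GE] := @dual_exists A 0 0 g z0.
have iE : injective_gmod Ek by case: hEk.
have [|H HE] := lifts_ker (f := F) (g := G) (injective_lifts_shift iE).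
  move=> a x e; apply: (pr_eq0 z0) => a0; rewrite GE mact_const //; exact: fg.
have hl : linear ((fun w => @pr B 0 0 H (w : B 0)) : W -> k^o) by exact: (@pr_linr B 0 0 H).
exists (mklinear hl) => v /=.
by rewrite -[LHS](pr_nat (H : matlis Ek B 0) F (v : A 0)) -GE -HE.
Qed.

End Pairing.
Arguments dual_ext {k n Ek iota} hEk {M t s f g}.

(** * Products of vector spaces, and finite direct sums *)

Section DependentProduct.
Variables (k : fieldType) (I : Type) (V : I -> lmodType k).

Definition dprod := forall i, V i.

HB.instance Definition _ := gen_eqMixin dprod.
HB.instance Definition _ := gen_choiceMixin dprod.

Fact dprodA : associative (fun (x y : dprod) i => x i + y i).
Proof. by move=> x y z; apply: functional_extensionality_dep => i; exact: addrA. Qed.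
Fact dprodC : commutative (fun (x y : dprod) i => x i + y i).
Proof. by move=> x y; apply: functional_extensionality_dep => i; exact: addrC. Qed.
Fact dprod0 : left_id (fun i => 0) (fun (x y : dprod) i => x i + y i).
Proof. by move=> x; apply: functional_extensionality_dep => i; exact: add0r. Qed.
Fact dprodN : left_inverse (fun i => 0) (fun (x : dprod) i => - x i)
  (fun (x y : dprod) i => x i + y i).
Proof. by move=> x; apply: functional_extensionality_dep => i; exact: addNr. Qed.

HB.instance Definition _ := GRing.isZmodule.Build dprod dprodA dprodC dprod0 dprodN.

Fact dprodZA (c e : k) (x : dprod) :
  (fun i => c *: (e *: x i)) = (fun i => (c * e) *: x i).
Proof. by apply: functional_extensionality_dep => i; exact: scalerA. Qed.
Fact dprodZ1 : left_id 1 (fun (c : k) (x : dprod) i => c *: x i).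
Proof. by move=> x; apply: functional_extensionality_dep => i; exact: scale1r. Qed.
Fact dprodZDr : right_distributive (fun (c : k) (x : dprod) i => c *: x i) +%R.
Proof. by move=> c x y; apply: functional_extensionality_dep => i; exact: scalerDr. Qed.
Fact dprodZDl (x : dprod) : {morph (fun (c : k) => (fun i => c *: x i) : dprod) : c e / c + e}.
Proof. by move=> c e; apply: functional_extensionality_dep => i; exact: scalerDl. Qed.

HB.instance Definition _ :=
  GRing.Zmodule_isLmodule.Build k dprod dprodZA dprodZ1 dprodZDr dprodZDl.

Lemma dprodE (c : k) (x y : dprod) i : (c *: x + y) i = c *: x i + y i.
Proof. by []. Qed.

Lemma dprod_sumE (J : Type) (r : seq J) (F : J -> dprod) i :
  (\sum_(j <- r) F j) i = \sum_(j <- r) F j i.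
Proof. by elim/big_rec2: _ => // j x y _ <-. Qed.

End DependentProduct.

Section DirectSum.
Variables (k : fieldType) (I : finType) (V : I -> lmodType k).

Definition single (j : I) (x : V j) : dprod V := @dfwith I V (fun i => 0 : V i) j x.

Lemma single_same j x : @single j x j = x.
Proof. exact: dfwith_in. Qed.

Lemma single_other j x i : j != i -> @single j x i = 0.
Proof. by move=> ji; exact: dfwith_out. Qed.

Fact single_lin j : linear (@single j).
Proof.
move=> c x y; apply: functional_extensionality_dep => i; rewrite dprodE.
have [<-|ji] := eqVneq j i; first by rewrite !single_same.
by rewrite !single_other // scaler0 addr0.
Qed.

HB.instance Definition _ j :=
  GRing.isLinear.Build k (V j) (dprod V) _ (@single j) (@single_lin j).

Lemma sum_single (U : lmodType k) (F : forall i, {linear V i -> U}) j x :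
  \sum_i F i (@single j x i) = F j x.
Proof.
rewrite (bigD1 j) //= single_same big1 ?addr0 // => i ij.
by rewrite single_other ?linear0 // eq_sym.
Qed.

Lemma dprod_decomp (x : dprod V) : x = \sum_i single (x i).
Proof.
apply: functional_extensionality_dep => j; rewrite dprod_sumE (bigD1 j) //=.
by rewrite single_same big1 ?addr0 // => i ij; rewrite single_other.
Qed.

Lemma linear_dprod (U : lmodType k) (h : {linear dprod V -> U}) x :
  h x = \sum_i h (single (x i)).
Proof. by rewrite {1}[x]dprod_decomp linear_sum. Qed.

End DirectSum.

(** * Exactness of the Matlis dual, transposition and biduals *)

Section Duality.
Variables (k : fieldType) (n : nat) (Ek : gmod k n) (iota : nat_hom (residue k n) Ek).
Hypothesis hEk : injective_hull iota.
Implicit Types (a b s t : deg n) (M N P E F : gmod k n).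

Local Notation D := (matlis Ek).
Local Notation Dmap := (matlis_map Ek).
Local Notation pr := (pr hEk).

(** If [w] is outside the range, the second projection factors through [(v, c) |-> f v + c w]; this
    gives a functional that kills the range and is 1 at [w]. *)
Lemma functional_separates (V W : lmodType k) (f : {linear V -> W}) w :
  (forall h : {linear W -> k^o}, (forall v, h (f v) = 0) -> h w = 0) -> exists v, f v = w.
Proof.
move=> hw; apply: contrapT => nw.
have fl : linear (fun p : V * k^o => f p.1 + (p.2 : k) *: w).
  by move=> c x y; rewrite linearP scalerDl scalerDr scalerA addrACA.
have gl : linear (fun p : V * k^o => p.2) by [].
have [[v c] /= e|h hE] := functional_factor hEk (f := mklinear fl) (g := (mklinear gl)).
  apply/eqP; apply: contraT => c0; case: nw; exists (- (c : k)^-1 *: v).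
  apply: (scalerI c0); rewrite linearZ scalerA mulrN divff // scaleN1r.
  by apply/eqP; rewrite eq_sym -addr_eq0 addrC e.
have h0 : h w = 0.
  by apply: hw => v; have := hE (v, 0); rewrite /= scale0r addr0.
have := hE (0, 1); rewrite /= linear0 add0r scale1r h0 => /eqP.
by rewrite eq_sym oner_eq0.
Qed.

Lemma pr_sumr M b a (f : D M b) (J : finType) (x : J -> M a) :
  pr f (\sum_j x j) = \sum_j pr f (x j).
Proof. exact: linear_sum. Qed.

Lemma pr_suml M b a (x : M a) (J : finType) (f : J -> D M b) :
  pr (\sum_j f j) x = \sum_j pr (f j) x.
Proof. exact: (linear_sum (prl hEk x)). Qed.

Lemma prBl M b a (x : M a) (f g : D M b) : pr (f - g) x = pr f x - pr g x.
Proof. exact: (linearB (prl hEk x)). Qed.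

Lemma pr0l M b a (x : M a) : pr (0 : D M b) x = 0.
Proof. exact: (linear0 (prl hEk x)). Qed.

Lemma pr_adj M a b (f : D M (- b)) (x : M a) : dle a b ->
  pr (mact (D M) (- b) (- a) f) x = pr f (mact M a b x).
Proof.
by move=> ab; rewrite pr_mactl ?dleN ?addNr // pr_mactr ?addNr.
Qed.

Lemma pr_adj' M a b (f : D M a) (x : M (- b)) : dle a b ->
  pr (mact (D M) a b f) x = pr f (mact M (- b) (- a) x).
Proof.
by move=> ab; rewrite pr_mactl ?addrN // pr_mactr ?dleN ?addrN.
Qed.

Lemma dual_epi M N (f : nat_hom M N) : epi f -> mono (Dmap f).
Proof.
move=> ef b g g' e; apply: nat_hom_ext => a y; have [x <-] := ef a y.
by rewrite -[LHS]/((Dmap f b g : nat_hom _ _) a x) e.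
Qed.

(** In each degree this is linear algebra: a functional that kills the range of [f], which is the
    kernel of [g], factors through [g]. *)
Lemma dual_exact M N P (f : nat_hom M N) (g : nat_hom N P) :
  exact_at f g -> exact_at (Dmap g) (Dmap f).
Proof.
move=> fg b y; split=> [e|[z <-]]; last first.
  apply: nat_hom_ext => a x; rewrite /= (_ : g a (f a x) = 0) ?linear0 //.
  by apply/fg; exists x.
have yl : linear (fun x : N (- b) => pr y x) by exact: linearP.
have [x /fg[z <-]|h hE] := functional_factor hEk (f := g (- b)) (g := mklinear yl).
  by rewrite /= -(pr_nat hEk y f z) [_ y]e pr0l.
have [z zE] := dual_exists hEk h (addrN b).
exists z; apply: (dual_ext hEk (addrN b)) => x.
by rewrite pr_nat zE hE.
Qed.

Lemma dual_mono M N (f : nat_hom M N) : mono f -> epi (Dmap f).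
Proof.
move=> /monoP mf b y.
have yl : linear (fun x : M (- b) => pr y x) by exact: linearP.
have [x /mf ->|h hE] := functional_factor hEk (f := f (- b)) (g := mklinear yl).
  exact: linear0.
have [z zE] := dual_exists hEk h (addrN b).
exists z; apply: (dual_ext hEk (addrN b)) => x.
by rewrite pr_nat zE hE.
Qed.

Section Transpose.
Variables (F M : gmod k n) (g : nat_hom F (D M)).

Fact transp_ex a (x : M a) : exists f : D F a, forall y : F (- a), pr f y = pr (g _ y) x.
Proof.
have l : linear (fun y : F (- a) => pr (g _ y) x).
  by move=> c y y'; rewrite linearP pr_linl.
have [f fE] := dual_exists hEk (mklinear l) (addrN a); by exists f.
Qed.

Definition transp_fun a (x : M a) : D F a := sval (cid (transp_ex x)).

Lemma transp_funE a (x : M a) (y : F (- a)) : pr (transp_fun x) y = pr (g _ y) x.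
Proof. by rewrite /transp_fun; case: cid => f /= ->. Qed.

(** A morphism from [F] to [D M] and one from [M] to [D F] both encode a balanced pairing of [F]
    with [M]; transposition swaps the arguments. *)
Definition transp : nat_hom M (D F).
Proof.
apply: (@nat_homB k n M (D F) transp_fun) => [a c x y|a b x ab].
  apply: (dual_ext hEk (addrN a)) => z.
  by rewrite pr_linl !transp_funE linearP.
apply: (dual_ext hEk (addrN b)) => z.
by rewrite pr_adj' // !transp_funE nfun_mact pr_adj.
Defined.

Lemma transpE a b (x : M a) (y : F b) : a + b = 0 -> pr (transp a x) y = pr (g b y) x.
Proof.
by move=> /eqP; rewrite addrC addr_eq0 => /eqP e; subst b; exact: transp_funE.
Qed.

End Transpose.

Definition bidual M : nat_hom M (D (D M)) := transp (nid (D M)).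

Lemma bidualE M a b (x : M a) (y : D M b) : a + b = 0 -> pr (bidual M a x) y = pr y x.
Proof. exact: transpE. Qed.

(** For nonzero [x], the identity of [k] factors through [c |-> c x], giving a functional with value
    1 at [x]. *)
Lemma dual_separates M a b (x : M a) : b + a = 0 -> (forall f : D M b, pr f x = 0) -> x = 0.
Proof.
move=> ba hx; apply: contrapT => x0.
have xl : linear (fun c : k^o => (c : k) *: x) by move=> c d e; rewrite scalerDl scalerA.
have [c /= e|h hE] := functional_factor hEk (f := mklinear xl) (g := idfun).
  by apply/eqP; apply: contra_notT x0 => c0; apply: (scalerI c0); rewrite e scaler0.
have [f fE] := dual_exists hEk h ba.
have := hx f; rewrite fE -[x]scale1r -[_ *: x]/(mklinear xl 1) hE /= => /eqP.
by rewrite oner_eq0.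
Qed.

Lemma bidual_mono M : mono (bidual M).
Proof.
apply/monoP => a x e; apply: (dual_separates (addNr a)) => f.
by rewrite -bidualE ?addrN // e pr0l.
Qed.

(* Baer's criterion says that [E a -> prod_j E (b j) -> prod_(i, j) E (dmax (b i) (b j))]
   is exact; the functionals [z] below witness exactness of its dual. *)
Lemma baer_bidual E : baer E -> baer (D (D E)).
Proof.
move=> bE a I b xi ab xiP.
have fl : linear (fun y : dprod (fun j : I => D E (- b j)) =>
    \sum_j mact (D E) (- b j) (- a) (y j)).
  move=> c y y'; rewrite scaler_sumr -big_split; apply: eq_bigr => j _.
  by rewrite dprodE linearP.
have gl : linear (fun y : dprod (fun j : I => D E (- b j)) => \sum_j pr (xi j) (y j) : k^o).
  move=> c y y'; rewrite scaler_sumr -big_split; apply: eq_bigr => j _.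
  by rewrite dprodE linearP.
(* A functional through which the family [xi] factors is the element sought; it exists if [xi] kills
   each [y] whose multiples sum to zero. *)
have [y|h hE] := functional_factor hEk (f := mklinear fl) (g := (mklinear gl)); last first.
  have [x xE] := dual_exists hEk h (addrN a).
  exists x => j; apply: (dual_ext hEk (addrN (b j))) => y.
  rewrite pr_adj' // xE.
  pose F i := mact (D E) (- b i) (- a) : {linear _ -> _}.
  pose G i := pr (xi i) : {linear D E (- b i) -> k^o}.
  have := hE (single y).
  by rewrite /= (sum_single F) (sum_single G).
rewrite -[mklinear fl y]/(\sum_j mact (D E) (- b j) (- a) (y j)) => y0.
pose c i j := dmax (b i) (b j).
pose W (ij : I * I) : lmodType k := E (c ij.1 ij.2).
have f2l : linear (fun v : dprod (fun j : I => E (b j)) =>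
    ((fun ij => mact E (b ij.1) (c ij.1 ij.2) (v ij.1) -
       mact E (b ij.2) (c ij.1 ij.2) (v ij.2)) : dprod W)).
  move=> r v v'; apply: functional_extensionality_dep => ij; rewrite !dprodE.
  by rewrite !linearP /= addrACA -scalerDr.
have g2l : linear (fun v : dprod (fun j : I => E (b j)) => \sum_j pr (y j) (v j) : k^o).
  move=> r v v'; rewrite scaler_sumr -big_split; apply: eq_bigr => j _.
  by rewrite dprodE linearP.
(* By [bE] a compatible family comes from [E a], where [y] vanishes; so [y], as a functional on
   families, factors through their differences. *)
have [v /= v0|h hE] := functional_factor hEk (f := mklinear f2l) (g := (mklinear g2l)).
  have [|e eE] := bE a I b v ab.
    move=> i j; apply/eqP; rewrite -subr_eq0; apply/eqP.
    exact: (congr1 (fun w : dprod W => w (i, j)) v0).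
  transitivity (pr (\sum_j mact (D E) (- b j) (- a) (y j)) e); last by rewrite y0 pr0l.
  rewrite pr_suml; apply: eq_bigr => j _.
  by rewrite pr_adj // eE.
have zx (ij : I * I) : exists z : D E (- c ij.1 ij.2), forall x, pr z x = h (single (x : W ij)).
  have l : linear (fun x : E (c ij.1 ij.2) => h (single (x : W ij))).
    by move=> r x x'; rewrite !linearP.
  by have [z zE] := dual_exists hEk (mklinear l) (addNr (c ij.1 ij.2)); exists z.
pose z ij := sval (cid (zx ij)).
have zE ij x : pr (z ij) x = h (single (x : W ij)) by rewrite /z; case: cid.
have yE l : y l = \sum_j mact (D E) (- c l j) (- b l) (z (l, j)) -
                  \sum_i mact (D E) (- c i l) (- b l) (z (i, l)).
  apply: (dual_ext hEk (addNr (b l))) => x.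
  pose G i := pr (y i) : {linear E (b i) -> k^o}.
  have := hE (single x); rewrite /= (sum_single G) => <-.
  rewrite linear_dprod prBl !pr_suml.
  pose sx := @single k I (fun j => E (b j)) l x.
  pose H1 j i := (pr (z (i, j))) \o (mact E (b i) (c i j)) : {linear E (b i) -> k^o}.
  pose H2 i j := (pr (z (i, j))) \o (mact E (b j) (c i j)) : {linear E (b j) -> k^o}.
  transitivity (\sum_ij (H1 ij.2 ij.1 (sx ij.1) - H2 ij.1 ij.2 (sx ij.2))).
    by apply: eq_bigr => -[i j] _; rewrite -zE linearB.
  rewrite sumrB; congr (_ - _).
    rewrite -(pair_big xpredT xpredT (fun i j => H1 j i (sx i))) /= exchange_big /=.
    by apply: eq_bigr => j _; rewrite (sum_single (H1 j)) /= pr_adj // dle_maxl.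
  rewrite -(pair_big xpredT xpredT (fun i j => H2 i j (sx j))) /=.
  by apply: eq_bigr => i _; rewrite (sum_single (H2 i)) /= pr_adj // dle_maxr.
rewrite -[LHS]/(\sum_j pr (xi j) (y j)) (eq_bigr (fun l => \sum_j pr (xi l) (mact (D E) (- c l j) (- b l) (z (l, j))) -
    \sum_i pr (xi l) (mact (D E) (- c i l) (- b l) (z (i, l))))); last first.
  by move=> l _; rewrite yE linearB /= !pr_sumr.
(* After the exchange, the two terms for each [z (l, j)] cancel by compatibility of [xi]. *)
rewrite sumrB [X in _ - X]exchange_big /= -sumrB big1 // => l _.
rewrite -sumrB big1 // => j _; apply/eqP; rewrite subr_eq0; apply/eqP.
by rewrite -!pr_adj' ?dle_maxl ?dle_maxr // xiP.
Qed.

(** It suffices that a functional killing the image of [E a] kills [e]. Such a functional is a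
    family [y] in the dual whose multiples in degree [- a] sum to zero; pairing this sum with a
    solution [xi] in the bidual gives the claim. *)
Lemma bidual_baer E : baer (D (D E)) -> baer E.
Proof.
move=> bE a I b e ab eP.
have fl : linear (fun x : E a => (fun j => mact E a (b j) x) : dprod (fun j : I => E (b j))).
  by move=> c x y; apply: functional_extensionality_dep => j; rewrite dprodE; exact: linearP.
suff [x xE] : exists x, mklinear fl x = (e : dprod (fun j : I => E (b j))).
  by exists x => j; rewrite -xE.
apply: functional_separates => h h0.
have yx j : exists y : D E (- b j), forall x : E (b j), pr y x = h (@single k I (fun j => E (b j)) j x).
  have l : linear (fun x : E (b j) => h (@single k I (fun j => E (b j)) j x)) by move=> r x x'; rewrite !linearP.
  by have [y yE] := dual_exists hEk (mklinear l) (addNr (b j)); exists y.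
pose y j := sval (cid (yx j)).
have yE j (x : E (b j)) : pr (y j) x = h (@single k I (fun j => E (b j)) j x) by rewrite /y; case: cid.
have hE v : h v = \sum_j pr (y j) (v j).
  by rewrite linear_dprod; apply: eq_bigr => j _; rewrite yE.
have y0 : \sum_j mact (D E) (- b j) (- a) (y j) = 0.
  apply: (dual_ext hEk (addNr a)) => x; rewrite pr0l pr_suml -[RHS](h0 x) hE.
  by apply: eq_bigr => j _; rewrite pr_adj.
have [i j|xi xiE] := bE a I b (fun j => bidual E (b j) (e j)) ab.
  by rewrite -!nfun_mact eP.
transitivity (pr xi (\sum_j mact (D E) (- b j) (- a) (y j))); last by rewrite y0 linear0.
rewrite hE pr_sumr; apply: eq_bigr => j _.
by rewrite -pr_adj' // xiE bidualE ?addrN.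
Qed.

Lemma injective_bidual E : injective_gmod (D (D E)) <-> injective_gmod E.
Proof.
rewrite !injective_baer; split; [exact: bidual_baer|exact: baer_bidual].
Qed.

End Duality.

(** * Flatness *)

Section TensorElements.
Variables (k : fieldType) (n : nat) (F M : gmod k n) (d : deg n).
Implicit Types a b : deg n.

Definition elt a (x : F a) (y : M (d - a)) : tens F M d := tclass [:: PTens a x y].

Lemma elt_linl a y : linear (fun x => @elt a x y).
Proof.
move=> c x x'; rewrite /elt scale_tclass add_tclass; apply/tclassP.
exact: teq_Dl.
Qed.

Lemma elt_linr a x : linear (@elt a x).
Proof.
move=> c y y'; rewrite /elt scale_tclass add_tclass; apply/tclassP.
apply: teq_trans (teq_Dr _ _ _) _; rewrite -cat1s -[X in teq _ X]cat1s.
by apply: teq_cat (teq_refl _); apply/teq_sym/teq_scaler.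
Qed.

Lemma elt_bal a b (x : F a) (y : M (d - b)) :
  elt (mact F a b x) y = elt x (mact M (d - b) (d - a) y).
Proof.
apply/tclassP; apply: teq_trans (teq_bal _ _ _) _.
rewrite (gact_eq _ (monP k (d - b) (d - a))); first exact: teq_refl.
by apply: mon_shift; rewrite [RHS]addrC opprB addrA subrK.
Qed.

Lemma tclass_cons g s : tclass (g :: s : tsum F M d) =
  elt (pt_left g) (pt_right g) + tclass s :> tens F M d.
Proof. by case: g => a x y; rewrite /elt /= add_tclass. Qed.

Lemma tclass_nil : tclass ([::] : tsum F M d) = 0 :> tens F M d.
Proof. by []. Qed.

Lemma tens_ind (P : tens F M d -> Prop) : P 0 ->
  (forall a x y t, P t -> P (@elt a x y + t)) -> forall t, P t.
Proof.
move=> P0 PD; elim/tclassW; elim=> [|g s IH]; first by rewrite tclass_nil.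
by rewrite tclass_cons; exact: PD.
Qed.

(** The universal property: the sum [sm] over a formal sum respects every generator of [teq]. *)
Lemma tens_functional (beta : forall a, F a -> M (d - a) -> k^o) :
  (forall a y, linear (fun x => beta a x y)) -> (forall a x, linear (beta a x)) ->
  (forall a b x y, dle a b ->
    beta b (mact F a b x) y = beta a x (mact M (d - b) (d - a) y)) ->
  exists phi : {linear tens F M d -> k^o}, forall a x y, phi (@elt a x y) = beta a x y.
Proof.
move=> bl br bb; pose sm (s : tsum F M d) := \sum_(g <- s) beta (pt_deg g) (pt_left g) (pt_right g).
have blZ a y (c : k) x : beta a (c *: x) y = c *: beta a x y.
  by rewrite -[LHS]/(mklinear (bl a y) _) linearZ.
have brZ a x (c : k) y : beta a x (c *: y) = c *: beta a x y.
  by rewrite -[LHS]/(mklinear (br a x) _) linearZ.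
have sm1 g : sm [:: g] = beta _ (pt_left g) (pt_right g) by rewrite /sm big_seq1.
have smE s t : teq s t -> sm s = sm t.
  elim=> {s t} [s|s t _ ->|s t u _ -> _ ->|s s' t t' _ h _ h'|s t|a y|a x x' y|a x y y'|a b p hp x y] //.
  - by move: h h'; rewrite /sm !big_cat /= => -> ->.
  - by rewrite /sm !big_cat /= addrC.
  - by rewrite sm1 /sm big_nil; exact: (linear0 (mklinear (bl a y))).
  - by rewrite sm1 /sm big_cons big_seq1; exact: (linearD (mklinear (bl a y))).
  - by rewrite sm1 /sm big_cons big_seq1; exact: (linearD (mklinear (br a x))).
  - rewrite !sm1 /= !gactE blZ brZ.
    have [ab|ab] := boolP (dle a b); first by rewrite bb.
    by rewrite (ev1_nle hp ab) !scale0r.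
have smC s : sm (repr (tclass s)) = sm s by apply/smE/repr_tclass.
have sml : linear ((fun t : tens_car F M d => sm (repr t)) : tens_car F M d -> k^o).
  move=> c; elim/tclassW=> s; elim/tclassW=> t.
  rewrite scale_tclass add_tclass !smC.
  rewrite /sm big_cat big_map scaler_sumr; congr (_ + _); apply: eq_bigr => g _ /=.
  exact: blZ.
exists (mklinear sml) => a x y /=.
by rewrite smC sm1.
Qed.

End TensorElements.

(** * Flatness as injectivity of the dual *)

Section FlatInjective.
Variables (k : fieldType) (n : nat) (Ek : gmod k n) (iota : nat_hom (residue k n) Ek).
Hypothesis hEk : injective_hull iota.
Implicit Types (a b d s t : deg n) (A B C F : gmod k n).

Local Notation D := (matlis Ek).
Local Notation pr := (pr hEk).

Lemma tens_map_elt F A B (f : nat_hom A B) d a (x : F a) (y : A (d - a)) :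
  tens_map F f d (elt x y) = elt x (f _ y).
Proof. exact: tmap_class. Qed.

Lemma tens_mapD F A B (f : nat_hom A B) d (x y : tens F A d) :
  tens_map F f d (x + y) = tens_map F f d x + tens_map F f d y.
Proof. exact: linearD. Qed.

Lemma elt0r F A d a (x : F a) : elt x (0 : A (d - a)) = 0.
Proof. exact: (linear0 (mklinear (elt_linr x))). Qed.

Lemma eltDr F A d a (x : F a) (y y' : A (d - a)) : elt x (y + y') = elt x y + elt x y'.
Proof. exact: (linearD (mklinear (elt_linr x))). Qed.

(** With [tens_uncurry], the adjunction between functionals on degree [d] of the tensor product and
    morphisms from [A(d)] to [D F]; [mact] is a cast here. *)
Lemma tens_curry F A d (phi : {linear tens F A d -> k^o}) :
  exists g : nat_hom (shift d A) (D F), forall a b (x : F a) (y : shift d A b),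
    b + a = 0 -> pr (g b y) x = phi (elt x (mact A (d + b) (d - a) y)).
Proof.
have ex b (y : shift d A b) : exists f : D F b, forall x : F (- b),
    pr f x = phi (elt x (mact A (d + b) (d - - b) y)).
  have l : linear (fun x : F (- b) => phi (elt x (mact A (d + b) (d - - b) y))).
    by move=> c x x'; rewrite elt_linl linearP.
  by have [f fE] := dual_exists hEk (mklinear l) (addrN b); exists f.
pose g b y := sval (cid (ex b y)).
have gE b y x : pr (g b y) x = phi (elt x (mact A (d + b) (d - - b) y)).
  by rewrite /g; case: cid.
have gl b : linear (g b).
  move=> c y y'; apply: (dual_ext hEk (addrN b)) => x.
  by rewrite pr_linl !gE linearP elt_linr linearP.
have ga b b' y : dle b b' -> g b' (mact (shift d A) b b' y) = mact (D F) b b' (g b y).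
  move=> bb'; apply: (dual_ext hEk (addrN b')) => x.
  rewrite pr_adj' // !gE mact_shift elt_bal !mact_comp ?opprK //.
    by rewrite dle_add2l.
  by rewrite dle_add2l.
exists (nat_homB gl ga) => a b x y.
by move=> /eqP; rewrite addrC addr_eq0 => /eqP e; subst a; exact: gE.
Qed.

Lemma tens_uncurry F A d (g : nat_hom (shift d A) (D F)) :
  exists phi : {linear tens F A d -> k^o}, forall a (x : F a) (y : A (d - a)),
    phi (elt x y) = pr (g (- a) y) x.
Proof.
apply: (tens_functional (beta := fun a x y => pr (g (- a) y) x)).
- by move=> a y; exact: pr_linr.
- by move=> a x c y y'; rewrite linearP pr_linl.
- move=> a b x y ab; rewrite -mact_shift nfun_mact pr_adj //.
Qed.

Definition shift_map d A B (f : nat_hom A B) : nat_hom (shift d A) (shift d B).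
Proof.
apply: (@nat_homB k n (shift d A) (shift d B) (fun a x => f (d + a) x)) => [a|a b x ab].
  by move=> c x y; rewrite linearP.
by rewrite !mact_shift nfun_mact.
Defined.

(** By adjunction [g] is a functional on degree 0 of [tens F A]; flatness embeds this in degree 0 of
    [tens F B], to which the functional extends. *)
Lemma flat_dual_lifts F : flat_gmod F -> lifts (D F).
Proof.
move=> fF A B f g mf; pose g0 := ncomp g (unshift0 A).
have [phi phiE] := tens_uncurry g0.
have se : short_exact f (quot_proj (im_is_submod f)).
  by split=> // [a y|]; [exact: quot_projP|exact: quot_proj_epi].
have [/monoP mt _ _] := fF _ _ _ _ _ se.
have [t /mt ->|psi psiE] := functional_factor hEk (f := tens_map F f 0) (g := phi).
  exact: linear0.
have [h0 h0E] := tens_curry psi.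
have hE : ncomp h0 (shift_map 0 f) = g0.
  apply: nat_hom_ext => b z; apply: (dual_ext hEk (addrN b)) => x.
  rewrite /= h0E ?addrN // -nfun_mact -tens_map_elt psiE phiE -mact_shift.
  by rewrite nfun_mact pr_mactl // ?opprK ?addrN.
have [uA [_ uAE]] := unshift0_iso A; have [uB [uBE _]] := unshift0_iso B.
have nat_u : ncomp (shift_map 0 f) uA = ncomp uB f.
  have e : ncomp (unshift0 B) (shift_map 0 f) = ncomp f (unshift0 A).
    by apply: nat_hom_ext => a x; rewrite /= nfun_mact.
  have -> : ncomp uB f = ncomp (ncomp uB (ncomp f (unshift0 A))) uA.
    by rewrite -!ncompA uAE ncompf1.
  by rewrite -e [ncomp uB _]ncompA uBE ncomp1f.
exists (ncomp h0 uB).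
by rewrite -ncompA -nat_u ncompA hE /g0 -ncompA uAE ncompf1.
Qed.

Lemma lifts_dual_flat F : lifts (D F) -> flat_gmod F.
Proof.
move=> lF A B C f g [mf fg eg]; split.
- move=> d; apply/monoP: d => d t t0.
  (* [functional_separates] for the zero map says that an element killed by all functionals is
     zero. *)
  have l0 : linear (fun _ : k^o => 0 : tens F A d) by move=> c x y; rewrite scaler0 addr0.
  suff [v <-] : exists v, mklinear l0 v = t by [].
  apply: (functional_separates hEk) => phi _.
  have [g1 g1E] := tens_curry phi.
  have [|h hE] := lF _ _ (shift_map d f) g1; first by move=> a; exact: mf.
  have [psi psiE] := tens_uncurry h.
  have -> : phi t = psi (tens_map F f d t).
    elim/tens_ind: t {t0} => [|a x y t IH]; first by rewrite !linear0.
    rewrite tens_mapD [LHS]linearD [RHS]linearD IH tens_map_elt psiE; congr (_ + _).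
    rewrite -[h _ _]/(ncomp h (shift_map d f) (- a) y) hE g1E ?addNr //.
    by rewrite mact_id.
  by rewrite t0 linear0.
- move=> d t; split=> [t0|[u <-]]; last first.
    elim/tens_ind: u => [|a x y u IH]; first by rewrite !linear0.
    rewrite !tens_mapD IH addr0 !tens_map_elt (_ : g _ (f _ y) = 0) ?elt0r //.
    by apply/fg; exists y.
  (* A functional that kills the image of [tens F A] descends to [tens F C] through chosen lifts
     along [g], hence kills [t]. *)
  apply: (functional_separates hEk) => h h0.
  pose s a y := sval (cid (eg a y)).
  have sP a y : g a (s a y) = y by rewrite /s; case: cid.
  have hs a (x : F a) y y' : g _ y = g _ y' -> h (elt x y) = h (elt (d := d) x y').
    move=> e; have [z zE] : exists z, f _ z = y - y'.
      by apply/fg; rewrite linearB /= e subrr.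
    by rewrite -[y](subrK y') -zE eltDr linearD /= -tens_map_elt h0 add0r.
  have [|||h' h'E] := @tens_functional k n F C d (fun a x y => h (elt x (s (d - a) y))).
  - by move=> a y c x x'; rewrite elt_linl linearP.
  - move=> a x c y y'; rewrite -linearP -elt_linr; apply: hs.
    by rewrite linearP /= !sP.
  - move=> a b x y ab; rewrite elt_bal; apply: hs.
    by rewrite nfun_mact !sP.
  have -> : h t = h' (tens_map F g d t).
    elim/tens_ind: t {t0} => [|a x y t IH]; first by rewrite !linear0.
    rewrite tens_mapD [LHS]linearD [RHS]linearD IH tens_map_elt h'E; congr (_ + _); apply: hs.
    by rewrite sP.
  by rewrite t0 linear0.
- move=> d; elim/tens_ind => [|a x y t [u uE]]; first by exists 0; rewrite linear0.
  have [z zE] := eg _ y; exists (elt x z + u).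
  by rewrite tens_mapD uE tens_map_elt zE.
Qed.

Lemma flat_dual F : flat_gmod F <-> injective_gmod (D F).
Proof.
by split=> [/flat_dual_lifts/injectiveP|/injectiveP/lifts_dual_flat].
Qed.

Lemma injective_dual_flat E : injective_gmod E <-> flat_gmod (D E).
Proof. by rewrite flat_dual (injective_bidual hEk). Qed.

End FlatInjective.

(** * Injective hulls and flat covers *)

Section Covers.
Variables (k : fieldType) (n : nat) (Ek : gmod k n) (iota : nat_hom (residue k n) Ek).
Hypothesis hEk : injective_hull iota.
Implicit Types (a b c : deg n) (M N P E F : gmod k n).

Local Notation D := (matlis Ek).
Local Notation Dmap := (matlis_map Ek).
Local Notation pr := (pr hEk).

Lemma prNl M b a (x : M a) (f : D M b) : pr (- f) x = - pr f x.
Proof. exact: (linearN (prl hEk x)). Qed.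

Lemma nfun_sum M N (f : nat_hom M N) a (J : finType) (x : J -> M a) :
  f a (\sum_j x j) = \sum_j f a (x j).
Proof. exact: linear_sum. Qed.

Lemma dual_comp M N P (f : nat_hom M N) (g : nat_hom N P) :
  Dmap (ncomp g f) = ncomp (Dmap f) (Dmap g).
Proof. by apply: nat_hom_ext => a y; exact: nat_hom_ext. Qed.

Lemma dual_id M : Dmap (nid M) = nid (D M).
Proof. by apply: nat_hom_ext => a y; exact: nat_hom_ext. Qed.

(** A functional that kills the joint kernel of the maps to the [E (b j)] factors through their
    product; its components there are the [z j]. *)
Lemma ann_decomp E a (I : finType) (b : I -> deg n) (y : D E (- a)) :
  (forall j, dle a (b j)) ->
  (forall e, (forall j, mact E a (b j) e = 0) -> pr y e = 0) ->
  exists z : forall j, D E (- b j), y = \sum_j mact (D E) (- b j) (- a) (z j).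
Proof.
move=> ab y0; pose W j := E (b j) : lmodType k.
have fl : linear (fun x : E a => (fun j => mact E a (b j) x) : dprod W).
  by move=> c x x'; apply: functional_extensionality_dep => j; rewrite dprodE; exact: linearP.
have yl : linear (fun x : E a => pr y x) by exact: pr_linr.
have [x x0|h hE] := functional_factor hEk (f := mklinear fl) (g := mklinear yl).
  by apply: y0 => j; exact: (congr1 (fun w : dprod W => w j) x0).
have ex j : exists z : D E (- b j), forall x : E (b j), pr z x = h (@single k I W j x).
  have l : linear (fun x : E (b j) => h (@single k I W j x)) by move=> r x x'; rewrite !linearP.
  by have [z zE] := dual_exists hEk (mklinear l) (addNr (b j)); exists z.
exists (fun j => sval (cid (ex j))); apply: (dual_ext hEk (addNr a)) => x.
rewrite -[LHS]/(mklinear yl x) -hE linear_dprod pr_suml; apply: eq_bigr => j _.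
by rewrite pr_adj //; case: cid => z /= ->.
Qed.

(** * The dual of an injective hull is a flat cover *)

Section HullToCover.
Variables (M E : gmod k n) (i : nat_hom M E).
Hypothesis hull_i : injective_hull i.

(** Factoring [g] through [Dmap i] is, after transposition, extending a morphism into the injective
    module [D F] along [i]. *)
Lemma hull_dual_precover : flat_precover (Dmap i).
Proof.
have [mi iE _] := hull_i; split; first exact/(injective_dual_flat hEk).
move=> F g /(flat_dual_lifts hEk) lF.
have [psi psiE] := lF _ _ i (transp hEk g) mi.
exists (transp hEk psi); apply: nat_hom_ext => a y.
apply: (dual_ext hEk (addrN a)) => m.
by rewrite pr_nat transpE ?addrN // -[psi _ _]/(ncomp psi i _ m) psiE transpE ?addNr.
Qed.

(* Among the [e] killed by the [x^(b j - a)] with [y(e) <> 0], choose one with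
   maximal annihilator [A], and [c] with [x^(c - a) e] nonzero in [M].  By
   maximality [y] vanishes on all elements killed by [A] and [x^(c - a)], so [y]
   is a combination of multiples of these monomials; since [y - h y] vanishes
   on [M], it then vanishes at [e]. *)
Lemma endo_vanish (h : nat_hom (D E) (D E)) a (I : finType) (b : I -> deg n) (y : D E (- a)) :
  ncomp (Dmap i) h = Dmap i -> (forall j, dle a (b j)) ->
  (forall e, (forall j, mact E a (b j) e = 0) -> pr (h _ y) e = 0) ->
  forall e, (forall j, mact E a (b j) e = 0) -> pr y e = 0.
Proof.
move=> ih ab hy e0 e0I; apply: contrapT => ye0.
pose T := {e : E a | (forall j, mact E a (b j) e = 0) /\ pr y e <> 0}.
pose A (e : T) c := dle a c /\ mact E a c (sval e) = 0.
have [|e emax] := @dickson_max n T (exist _ e0 (conj e0I ye0)) A a.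
  move=> e c c' [ac ec] cc'; split; first exact: dle_trans cc'.
  by rewrite -(mact_comp _ ac cc') ec linear0.
case: e emax => e [eI ye] emax.
have en0 : e != 0 by apply/eqP => ez; case: (ye); rewrite ez; exact: linear0.
have [c [m [ac ecm n0]]] := hull_meets hull_i en0.
have [s [sA sb]] := dickson_basis (fun c => mact E a c e = 0) a.
(* Generators of the annihilator of [e], together with [c]. *)
pose bs (j : option 'I_(size s)) := if j is Some j then tnth (in_tuple s) j else c.
have sP j : mact E a (tnth (in_tuple s) j) e = 0 /\ dle a (tnth (in_tuple s) j).
  exact/sA/(mem_tnth j (in_tuple s)).
have abs j : dle a (bs j) by case: j => [j|] //=; have [] := sP j.
have kill e' : (forall j, mact E a (bs j) e' = 0) ->
    forall c', dle a c' -> mact E a c' e = 0 -> mact E a c' e' = 0.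
  move=> e's c' ac' ec'; have [v vs vc'] := sb _ ec' ac'.
  have /tnthP[j vj] : v \in in_tuple s by [].
  rewrite vj in vc'; have := e's (Some j) => /= e'j.
  by rewrite -(mact_comp _ (abs (Some j)) vc') /= e'j linear0.
(* An [e'] on which [y] does not vanish would have a strictly larger annihilator than [e], since it
   contains [c]. *)
have [e' e's|z yz] := ann_decomp (y := y) abs.
  apply: contrapT => ye'.
  have e'I j : mact E a (b j) e' = 0 by exact: kill.
  have [||_] := emax (exist _ e' (conj e'I ye')) _ c ac.
  - by move=> c' ac' [_ ec']; split=> //; exact: kill.
  - by split=> //; exact: (e's None).
  - by rewrite /= ecm => e1; rewrite e1 eqxx in n0.
case: (ye); rewrite -[y](subrK (h _ y)) -[RHS]addr0 -{2}(hy e eI).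
have -> : pr (y - h _ y + h _ y) e = pr (y - h _ y) e + pr (h _ y) e.
  exact: (linearD (prl hEk e)).
have hz : h _ y = \sum_j mact (D E) (- bs j) (- a) (h _ (z j)).
  by rewrite {1}yz nfun_sum; apply: eq_bigr => j _; rewrite nfun_mact.
congr (_ + _); rewrite prBl hz yz !pr_suml -sumrB big1 // => j _.
rewrite !pr_adj //= -prBl; case: j => [j|] /=.
  by have [-> _] := sP j; rewrite linear0.
rewrite ecm -pr_nat linearB /= -[ncomp (h _ _ : nat_hom _ _) i]/(ncomp (Dmap i) h _ (z None)).
by rewrite ih subrr pr0l.
Qed.

Lemma endo_mono (h : nat_hom (D E) (D E)) : ncomp (Dmap i) h = Dmap i -> mono h.
Proof.
move=> ih; apply/monoP => a; rewrite -[a]opprK => y hy0.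
apply: (dual_ext hEk (addNr (- a))) => e; rewrite pr0l.
(* The empty family of monomials puts no condition on [e']. *)
apply: (@endo_vanish h _ void (fun j => match j with end) y) => // e' _.
by rewrite hy0 pr0l.
Qed.

(* Lift a compatible family to [xi], and correct it by a functional [eta] that
   agrees with [xi] on the image of [h] and kills the ideal; [eta] exists because
   [h] is injective modulo the ideal. *)
Lemma endo_ker_baer (h : nat_hom (D E) (D E)) : ncomp (Dmap i) h = Dmap i ->
  baer (sub_gmod (ker_is_submod (Dmap h))).
Proof.
move=> ih a I b e ab eP; set K := ker_is_submod _ in e eP *.
have iE : injective_gmod (D (D E)).
  by apply/(injective_bidual hEk); case: hull_i.
pose zeta j := sub_incl K (b j) (e j).
have [|xi xiE] := (injective_baer _).1 iE a I b zeta ab.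
  by move=> j j'; rewrite -!nfun_mact eP.
pose W j := D E (- b j) : lmodType k.
have fl : linear (fun p : D E (- a) * dprod W =>
    h _ p.1 + \sum_j mact (D E) (- b j) (- a) (p.2 j)).
  move=> c p q; rewrite linearP scalerDr addrACA; congr (_ + _).
  rewrite scaler_sumr -big_split; apply: eq_bigr => j _.
  exact: (linearP (mact (D E) (- b j) (- a)) c (p.2 j) (q.2 j)).
have gl : linear (fun p : D E (- a) * dprod W => pr xi (h _ p.1)).
  by move=> c p q; rewrite !linearP.
(* Well-definedness of [psi]: if [h y] is a combination of multiples by the monomials, so is [y] by
   [endo_vanish], and then [xi] kills [h y] because the [zeta j] lie in the kernel of [Dmap h]. *)
have [[y w]|psi psiE] := functional_factor hEk (f := mklinear fl) (g := mklinear gl).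
  rewrite -[mklinear fl _]/(h _ y + \sum_j mact (D E) (- b j) (- a) (w j)) => e0.
  rewrite -[LHS]/(pr xi (h _ y)).
  have [|z ->] := ann_decomp (y := y) ab.
    apply: (endo_vanish ih ab) => x x0.
    move/eqP: e0; rewrite addr_eq0 => /eqP ->.
    rewrite prNl pr_suml big1 ?oppr0 // => j _.
    by rewrite pr_adj // x0 linear0.
  rewrite nfun_sum pr_sumr big1 // => j _; rewrite nfun_mact -pr_adj' // xiE -pr_nat.
  have -> : Dmap h _ (zeta j) = 0 by apply: (sub_inclP K (zeta j)).2; exists (e j).
  exact: pr0l.
have [eta etaE] := dual_exists hEk psi (addrN a).
have eta_h (y : D E (- a)) : pr eta (h _ y) = pr xi (h _ y).
  rewrite etaE -[RHS](psiE (y, 0)); congr (psi _).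
  rewrite -[mklinear fl _]/(h _ y + \sum_j mact (D E) (- b j) (- a) 0).
  by rewrite big1 ?addr0 // => j _; rewrite linear0.
have eta_b j (w : D E (- b j)) : pr eta (mact (D E) (- b j) (- a) w) = 0.
  rewrite etaE; transitivity (mklinear gl (0, @single k I W j w)).
    2: by rewrite -[LHS]/(pr xi (h (- a) 0)) !linear0.
  rewrite -psiE; congr (psi _).
  rewrite -[mklinear fl _]/(h (- a) 0 + \sum_i mact (D E) (- b i) (- a) (@single k I W j w i)).
  rewrite linear0 add0r.
  by rewrite (sum_single (fun j => mact (D E) (- b j) (- a) : {linear _ -> _})).
have [u uE] : exists u, sub_incl K a u = xi - eta.
  apply/sub_inclP; apply: (dual_ext hEk (addrN a)) => y.
  by rewrite pr0l pr_nat prBl eta_h subrr.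
exists u => j; apply: (sub_incl_mono (hS := K)); rewrite nfun_mact uE.
have -> : mact (D (D E)) a (b j) (xi - eta) = zeta j - mact (D (D E)) a (b j) eta.
  by rewrite -xiE; exact: linearB.
rewrite (_ : mact (D (D E)) a (b j) eta = 0) ?subr0 //.
by apply: (dual_ext hEk (addrN (b j))) => w; rewrite pr0l pr_adj'.
Qed.

(** The kernel of the epimorphism [Dmap h] is injective, so [Dmap h] has a section [s]; the
    transpose of [s] restricted to [E] is a retraction of [h]. *)
Lemma endo_retract (h : nat_hom (D E) (D E)) : ncomp (Dmap i) h = Dmap i ->
  exists r, ncomp r h = nid (D E).
Proof.
move=> ih; set K := ker_is_submod (Dmap h).
have lK : lifts (sub_gmod K) by apply/baer_lifts/endo_ker_baer.
have [rho rhoE] := lK _ _ (sub_incl K) (nid _) (@sub_incl_mono _ _ _ _ K).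
have eh : epi (Dmap h) by apply: (dual_mono hEk); exact: endo_mono.
have [|s sE] := epi_factor (h := nid _ - ncomp (sub_incl K) rho) eh.
  move=> a x x0; have [u <-] : exists u, sub_incl K a u = x by apply/sub_inclP.
  rewrite -[LHS]/(sub_incl K a u - sub_incl K a (ncomp rho (sub_incl K) a u)) rhoE.
  exact: subrr.
exists (transp hEk (ncomp s (bidual hEk E))); apply: nat_hom_ext => a y.
apply: (dual_ext hEk (addrN a)) => e.
rewrite transpE ?addrN // -[RHS](bidualE hEk e y (addNr a)) -pr_nat.
have [x xE] := eh _ (bidual hEk E (- a) e).
rewrite -[ncomp s _ _ e]/(s _ (bidual hEk E (- a) e)) -xE.
rewrite -[s _ _]/(ncomp s (Dmap h) _ x) sE.
have r0 : Dmap h (- a) (sub_incl K _ (rho _ x)) = 0.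
  by apply: (sub_inclP K _).2; exists (rho _ x).
have -> : Dmap h (- a) ((nid _ - ncomp (sub_incl K) rho : nat_hom _ _) _ x) =
    Dmap h (- a) x - Dmap h (- a) (sub_incl K _ (rho _ x)) by exact: linearB.
by rewrite r0 subr0.
Qed.

Lemma hull_dual_cover : flat_cover (Dmap i).
Proof.
split=> [|h ih]; first exact: hull_dual_precover.
have [r rh] := endo_retract ih.
(* Any retraction [r] corrected by the projection [1 - h r] is compatible with [Dmap i]. *)
pose r' : nat_hom (D E) (D E) := r + (nid (D E) - ncomp h r).
have ir' : ncomp (Dmap i) r' = Dmap i.
  by rewrite ncompDr ncompDr ncompNr ncompA ih ncompf1 addrC subrK.
have r'h : ncomp r' h = nid (D E).
  by rewrite !ncompDl ncompNl -ncompA rh ncompf1 ncomp1f subrr addr0.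
(* Since [r'] is injective, [r' h = 1] also gives [h r' = 1]. *)
exists r'; split=> //; apply: nat_hom_ext => a y; apply: (endo_mono ir').
by rewrite -[LHS]/(ncomp r' h a (r' a y)) r'h.
Qed.

End HullToCover.

(* If [S] misses [M] then [i] extends along [M -> E / S] to an endomorphism [p] of [E]
   killing [S]; its dual is invertible by the cover property, so [S = 0]. *)
Lemma dual_cover_hull M E (i : nat_hom M E) : mono i -> flat_cover (Dmap i) ->
  injective_hull i.
Proof.
move=> mi [[fE _] cov]; have iE : injective_gmod E by apply/(injective_dual_flat hEk).
split=> // S hS [a [x [Sx x0]]]; apply: contrapT => no.
have mq : mono (ncomp (quot_proj hS) i).
  apply/monoP => b m /quot_projP Sm; apply: contrapT => m0; apply: no.
  exists b, m; split=> //; apply/eqP => im0; apply: m0; exact: (monoP _).1 im0.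
have [psi psiE] := (injectiveP E).1 iE _ _ _ i mq.
pose p := ncomp psi (quot_proj hS).
have [|g [_ pg]] := cov (Dmap p).
  by rewrite -dual_comp (_ : ncomp p i = i) // -[RHS]psiE; exact: nat_hom_ext.
(* Every [y] is in the image of [Dmap p], so it vanishes at [x], which [p] kills. *)
move/eqP: x0; apply; apply: (dual_separates (hEk := hEk) (addNr a)) => y.
rewrite -[y]/(nid (D E) _ y) -pg pr_nat.
rewrite -[p a x]/(psi a (quot_proj hS a x)) (quot_projP hS x).2 // linear0.
exact: linear0.
Qed.

Lemma hull_cover M E (i : nat_hom M E) : mono i ->
  (injective_hull i <-> flat_cover (Dmap i)).
Proof. by move=> mi; split; [exact: hull_dual_cover|exact: dual_cover_hull]. Qed.

(** * Transport along isomorphisms and passage to images *)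

Lemma iso_comp M N P (g : nat_hom N P) (f : nat_hom M N) : iso g -> iso f -> iso (ncomp g f).
Proof.
move=> [g' [g'g gg']] [f' [f'f ff']]; exists (ncomp f' g'); split.
  by rewrite -ncompA [ncomp g' _]ncompA g'g ncomp1f.
by rewrite -ncompA [ncomp f _]ncompA ff' ncomp1f.
Qed.

Lemma flat_iso F F' (f : nat_hom F F') : iso f -> flat_gmod F' -> flat_gmod F.
Proof.
case=> g [gf fg]; rewrite !(flat_dual hEk) => /injectiveP lF; apply/injectiveP.
have i : iso (Dmap f).
  by exists (Dmap g); rewrite -!dual_comp fg gf !dual_id.
exact: lifts_iso i lF.
Qed.

Lemma flat_cover_iso F F' M M' (f : nat_hom F M) (f' : nat_hom F' M')
    (al : nat_hom F F') (be : nat_hom M M') : iso al -> iso be ->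
  ncomp f' al = ncomp be f -> flat_cover f' -> flat_cover f.
Proof.
move=> [al' [ala alb]] [be' [bea beb]] sq [[fF pre] cov].
have sq' : ncomp f al' = ncomp be' f'.
  by rewrite -[f]ncomp1f -bea -[ncomp (ncomp be' be) f]ncompA -sq -!ncompA alb ncompf1.
split; first split.
- by apply: (flat_iso (f := al)) fF; exists al'.
- move=> G g fG; have [h hE] := pre G (ncomp be g) fG; exists (ncomp al' h).
  by rewrite ncompA sq' -ncompA hE ncompA bea ncomp1f.
- move=> h fh; have [|h' [h'1 h'2]] := cov (ncomp al (ncomp h al')).
    by rewrite ncompA sq -!ncompA [ncomp f _]ncompA fh sq' ncompA beb ncomp1f.
  have -> : h = ncomp al' (ncomp (ncomp al (ncomp h al')) al).
    by rewrite -!ncompA ala ncompf1 ncompA ala ncomp1f.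
  by apply: iso_comp; [exists al|apply: iso_comp; [exists h'|exists al']].
Qed.

Lemma flat_cover_isoE F F' M M' (f : nat_hom F M) (f' : nat_hom F' M')
    (al : nat_hom F F') (be : nat_hom M M') : iso al -> iso be ->
  ncomp f' al = ncomp be f -> (flat_cover f' <-> flat_cover f).
Proof.
move=> ia ib sq; split; first exact: flat_cover_iso sq.
have [al' [ala alb]] := ia; have [be' [bea beb]] := ib.
apply: (flat_cover_iso (al := al') (be := be')); [by exists al|by exists be|].
by rewrite -[f]ncomp1f -bea -[ncomp (ncomp be' be) f]ncompA -sq -!ncompA alb ncompf1.
Qed.

Lemma im_proj_epi M N (f : nat_hom M N) : epi (im_proj f).
Proof.
by move=> a [y /= yf]; have /asboolP[x e] := yf; exists x; apply: val_inj.
Qed.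

Lemma im_proj_eq0 M N (f : nat_hom M N) a x : im_proj f a x = 0 <-> f a x = 0.
Proof.
split=> [e|e]; first by rewrite -[f a x]/(val (im_proj f a x)) e.
exact: val_inj.
Qed.

(** The image of [Dmap g] is the dual of the image of [g]: both are quotients of [D E] by the
    functionals that vanish on the image of [g]. *)
Lemma hull_im_cover M E (g : nat_hom M E) :
  injective_hull (im_incl g) <-> flat_cover (im_proj (Dmap g)).
Proof.
have mi : mono (im_incl g) by move=> a; exact: val_inj.
rewrite (hull_cover mi); have [||a y|be ib beE] :=
    epi_same_ker (g := im_proj (Dmap g)) (h := Dmap (im_incl g)).
- exact: im_proj_epi.
- exact: (dual_mono hEk).
- rewrite im_proj_eq0; split=> [e|e].
    apply: nat_hom_ext => b x; have [z <-] := im_proj_epi x.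
    by rewrite -[LHS]/((Dmap g a y : nat_hom _ _) b z) e.
  apply: nat_hom_ext => b z.
  by rewrite -[LHS]/((Dmap (im_incl g) a y : nat_hom _ _) b (im_proj g b z)) e.
- apply: (flat_cover_isoE (al := nid _) (be := be)) => //; last by rewrite ncompf1.
  by exists (nid _); split; exact: nat_hom_ext.
Qed.

(** A dual element is determined by its values on a finite spanning family [e], so [xi] factors
    through these values; the coefficients of the factor give a preimage. *)
Lemma bidual_iso F : pointwise_finite_dim F -> iso (bidual hEk F).
Proof.
move=> pF; apply: mono_epi_iso; first exact: bidual_mono.
move=> a xi; have [m [e eP]] := pF a.
have fl : linear (fun y : D F (- a) => (fun j : 'I_m => pr y (e j)) : dprod (fun _ : 'I_m => k^o)).
  by move=> c y y'; apply: functional_extensionality_dep => j; rewrite pr_linl.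
have gl : linear (fun y : D F (- a) => pr xi y) by exact: pr_linr.
have [y y0|h hE] := functional_factor hEk (f := mklinear fl) (g := mklinear gl).
  rewrite -[LHS]/(pr xi y) (_ : y = 0) ?linear0 //.
  apply: (dual_ext hEk (addNr a)) => x; have [c ->] := eP x.
  rewrite pr0l pr_sumr big1 // => j _; rewrite linearZ /=.
  rewrite -[pr y (e j)]/(mklinear fl y j) y0; exact: mulr0.
exists (\sum_j h (@single k _ (fun _ : 'I_m => k^o) j 1) *: e j).
apply: (dual_ext hEk (addrN a)) => y.
rewrite bidualE ?addrN // pr_sumr -[RHS]/(mklinear gl y) -hE linear_dprod.
apply: eq_bigr => j _; rewrite linearZ /=.
rewrite -[pr y (e j) in RHS]mulr1 -[(pr y (e j) * 1)]/((pr y (e j) : k) *: (1 : k^o)).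
by rewrite !linearZ /=; exact: mulrC.
Qed.

(** This reduces to [hull_im_cover] for [Dmap f]: the images of [f] and of its bidual are quotients
    of [F] by the same kernel, since [bidual] is injective on [M] and bijective on [F]. *)
Lemma cover_im_hull F M (f : nat_hom F M) : pointwise_finite_dim F ->
  (flat_cover (im_proj f) <-> injective_hull (im_incl (Dmap f))).
Proof.
move=> pF; rewrite hull_im_cover.
pose g := ncomp (im_proj (Dmap (Dmap f))) (bidual hEk F).
have [||a x|be ib beE] := epi_same_ker (g := im_proj f) (h := g).
- exact: im_proj_epi.
- move=> a y; have [z <-] := im_proj_epi y.
  have [bi [_ bib]] := bidual_iso pF.
  by exists (bi a z); rewrite -[z in RHS]/(nid _ a z) -bib.
- rewrite -[g a x]/(im_proj _ a (bidual hEk F a x)) !im_proj_eq0.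
  have -> : Dmap (Dmap f) a (bidual hEk F a x) = bidual hEk M a (f a x).
    by apply: (dual_ext hEk (addrN a)) => y; rewrite pr_nat !bidualE ?addrN.
  split=> [->|]; [exact: linear0|exact: ((monoP _).1 (@bidual_mono _ _ _ _ hEk M))].
- apply: iff_sym; apply: (flat_cover_isoE (al := bidual hEk F) (be := be)) => //.
  exact: bidual_iso.
Qed.

End Covers.

(** * Passage to resolutions *)

Theorem corollary3p2p3 (k : fieldType) (n : nat)
    (Ek : gmod k n) (iota : nat_hom (residue k n) Ek)
    (hEk : injective_hull iota) (M : gmod k n) :
  (forall (E : nat -> gmod k n) (eps : nat_hom M (E 0%N))
      (d : forall i, nat_hom (E i) (E i.+1)),
    coresolution eps d ->
    minimal_injective_resolution eps d <->
    @minimal_flat_resolution k n (matlis Ek M) (fun i => matlis Ek (E i))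
      (matlis_map Ek eps) (fun i => matlis_map Ek (d i)))
  /\
  (forall (F : nat -> gmod k n) (eps : nat_hom (F 0%N) M)
      (d : forall i, nat_hom (F i.+1) (F i)),
    resolution eps d ->
    (forall i, pointwise_finite_dim (F i)) ->
    minimal_flat_resolution eps d <->
    @minimal_injective_resolution k n (matlis Ek M) (fun i => matlis Ek (F i))
      (matlis_map Ek eps) (fun i => matlis_map Ek (d i))).
Proof.
split=> [E eps d res|F eps d res pF].
- have dres : @resolution k n (matlis Ek M) (fun i => matlis Ek (E i))
      (matlis_map Ek eps) (fun i => matlis_map Ek (d i)).
    case: res => meps e0 e; split=> [||i];
      [exact: (dual_mono hEk)|exact: (dual_exact hEk)|exact: (dual_exact hEk)].
  split=> -[_ h0 h]; split=> // [|i]; exact/(hull_im_cover hEk).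
- have dres : @coresolution k n (matlis Ek M) (fun i => matlis Ek (F i))
      (matlis_map Ek eps) (fun i => matlis_map Ek (d i)).
    case: res => eeps e0 e; split=> [||i];
      [exact: dual_epi|exact: (dual_exact hEk)|exact: (dual_exact hEk)].
  split=> -[_ h0 h]; split=> // [|i]; exact/(cover_im_hull hEk).
Qed.
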